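(* Let $K,N\ge 1$ be integers, let $\pi_1,\dots,\pi_K>0$ with $\sum_{c=1}^K\pi_c=1$, and for each $c\in\{1,\dots,K\}$ let $\mathbf R_c\in\mathbb C^{N\times N}$ be a covariance matrix (Hermitian positive semidefinite) with eigenvalues $\lambda_{c,1}\ge\cdots\ge\lambda_{c,N}\ge 0$. Let $R_c(\cdot)$ be the rate--distortion function of $\mathcal{CN}(\mathbf 0,\mathbf R_c)$ (see the context) and, for a distortion level $D$, define $$R_{\rm cond}(D)=\min_{\{D_c\ge 0\}:\ \sum_{c=1}^{K}\pi_c D_c\le D}\ \sum_{c=1}^{K}\pi_c R_c(D_c).$$ Then the optimizer of this minimization is characterized by a single global water level $\mu$, common to all components (that is, every component $c$ is coded with water level $\mu_c=\mu$, so that $D_c=\frac1N\sum_{m=1}^N\min\{\lambda_{c,m},\mu\}$), such that $$R_{\rm cond}(D)=\frac{1}{N}\sum_{c=1}^{K}\pi_c\sum_{m=1}^{N}\left[\log_2\!\left(\frac{\lambda_{c,m}}{\mu}\right)\right]_+,$$ $$D=\frac{1}{N}\sum_{c=1}^{K}\pi_c\sum_{m=1}^{N}\min\{\lambda_{c,m},\mu\}.$$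
   Context: Notation: $[x]_+=\max\{x,0\}$; the term $[\log_2(\lambda/\mu)]_+$ is read as $0$ whenever $\lambda\le\mu$ and as $+\infty$ when $\lambda>\mu=0$. $\mathcal{CN}(\mathbf 0,\mathbf R)$ is the zero-mean proper complex Gaussian law with covariance $\mathbf R$. Water levels are nonnegative real numbers. $R_c$ is the rate--distortion function, in bits per complex dimension, of $\mathbf h\sim\mathcal{CN}(\mathbf 0,\mathbf R_c)$ in $\mathbb C^N$ under squared error: $R_c(D_c)=\frac1N\inf I(\mathbf h;\hat{\mathbf h})$, the infimum being over conditional laws $p(\hat{\mathbf h}|\mathbf h)$ with $\frac1N\mathbb E\|\mathbf h-\hat{\mathbf h}\|_2^2\le D_c$. By classical rate--distortion theory it admits the parametric (reverse-waterfilling) form $$R_c(D_c)=\frac1N\sum_{m=1}^N\left[\log_2\!\left(\frac{\lambda_{c,m}}{\mu_c}\right)\right]_+,\qquad D_c=\frac1N\sum_{m=1}^N\min\{\lambda_{c,m},\mu_c\},$$ for some water level $\mu_c\ge0$. $R_{\rm cond}(D)$ is the rate needed at average distortion $D$ when the component index $c$, which has probability $\pi_c$, is known to both encoder and decoder. Each $R_c$ is convex and nonincreasing.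
   Formalization: The distortion level D is restricted to 0 ≤ D ≤ (1/N) Σ_c π_c Σ_m λ_{c,m}; outside this range the displayed equation for D has no water level μ ≥ 0, so the claim as stated fails there. *)

(* Defs.v *)
From HB Require Import structures.
From mathcomp Require Import all_boot all_order all_algebra.
From mathcomp Require Import spectral sesquilinear.
From mathcomp Require Import all_classical all_reals all_analysis.
From mathcomp Require Import measurable_realfun.
From mathcomp.real_closed Require Import complex.

Set Implicit Arguments.
Unset Strict Implicit.
Unset Printing Implicit Defensive.

Import Order.TTheory GRing.Theory Num.Theory numFieldNormedType.Exports.

Local Open Scope classical_set_scope.
Local Open Scope ring_scope.
Local Open Scope complex_scope.
Local Open Scope sesquilinear_scope.

Definition log2 (R : realType) (x : R) : R := ln x / ln 2.

Section projections.
Context d1 d2 (X : measurableType d1) (Y : measurableType d2).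

HB.instance Definition _ :=
  isMeasurableFun.Build _ _ (X * Y)%type X fst (measurable_fst (T1 := X) (T2 := Y)).
HB.instance Definition _ :=
  isMeasurableFun.Build _ _ (X * Y)%type Y snd (measurable_snd (T1 := X) (T2 := Y)).

End projections.

Section information.
Local Open Scope ereal_scope.
Context {R : realType}.

(* The integral makes sense in [\bar R] even when the integrand is not
   integrable: the negative part of [log2 (dP/dQ)] always is. *)
Definition kl_divergence d (T : measurableType d) (P Q : probability T R) : \bar R :=
  if pselect (P `<< Q) then
    \int[P]_x (log2 (fine ((Radon_Nikodym (charge_of_finite_measure P) Q) x)))%:E
  else +oo.

Definition mutual_information d1 d2 (X : measurableType d1)
    (Y : measurableType d2) (J : probability (X * Y)%type R) : \bar R :=
  kl_divergence J (distribution J (@fst X Y) \x distribution J (@snd X Y)).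

Section joint.
Context d1 d2 (X : measurableType d1) (Y : measurableType d2).
Variables (P : probability X R) (k : R.-pker X ~> Y).

Definition joint_law (S : set (X * Y)) : \bar R := \int[P]_x k x (xsection S x).

Let joint_law0 : joint_law set0 = 0.
Proof. by apply: integral0_eq => x _; rewrite xsection0 measure0. Qed.

Let joint_law_ge0 S : 0 <= joint_law S.
Proof. by apply: integral_ge0 => x _; exact: measure_ge0. Qed.

Let joint_law_sigma_additive : semi_sigma_additive joint_law.
Proof.
move=> F mF tF mUF.
have -> : joint_law (\bigcup_n F n) = \sum_(n <oo) joint_law (F n).
  rewrite /joint_law -integral_nneseries//; last first.
    by move=> n; apply: measurable_fun_xsection_finite_kernel; rewrite inE.
  apply: eq_integral => x _; rewrite xsection_bigcup.
  apply/esym/cvg_lim => //; apply: measure_semi_sigma_additive.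
  - by move=> n; exact: measurable_xsection.
  - exact: trivIset_xsection.
  - by apply: bigcupT_measurable => n; exact: measurable_xsection.
by apply: is_cvg_nneseries => n _ _; exact: joint_law_ge0.
Qed.

HB.instance Definition _ := isMeasure.Build _ _ _ joint_law
  joint_law0 joint_law_ge0 joint_law_sigma_additive.

Let joint_lawT : joint_law setT = 1.
Proof.
rewrite /joint_law (eq_integral (cst 1)); last first.
  by move=> x _; rewrite xsectionE preimage_setT prob_kernel.
by rewrite integral_cst// mul1e; exact: probability_setT.
Qed.

HB.instance Definition _ :=
  Measure_isProbability.Build _ _ _ joint_law joint_lawT.

End joint.

End information.

Definition complex_display : measure_display.
Proof. exact: default_measure_display. Qed.

Section complex_measurable.
Context {R : realType}.

HB.instance Definition _ := isPointed.Build R[i] 0.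

Definition pair_of_complex (z : R[i]) : R * R := (complex.Re z, complex.Im z).
(* [measurableTypeR R] is the copy of [R] on which the library puts
   [normal_prob]; its measurable sets are those of [R]. *)
Definition complex_of_pair (p : measurableTypeR R * measurableTypeR R) : R[i] :=
  (p.1 : R) +i* (p.2 : R).

Let sa : sigma_algebra setT
  (preimage_set_system setT pair_of_complex (@measurable _ (R * R)%type)).
Proof. by apply: sigma_algebra_preimage; exact: sigma_algebra_measurable. Qed.

Let m0 := let: And3 h _ _ := sa in h.
Let mC A : preimage_set_system setT pair_of_complex measurable A ->
  preimage_set_system setT pair_of_complex measurable (~` A).
Proof. by move=> mA; rewrite -setTD; case: sa => _ + _; exact. Qed.
Let mU := let: And3 _ _ h := sa in h.

(* Borel sigma-algebra of C, transported from R x R *)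
HB.instance Definition _ := @isMeasurable.Build complex_display R[i]
  (preimage_set_system setT pair_of_complex measurable) m0 mC mU.

Lemma measurable_pair_of_complex : measurable_fun setT pair_of_complex.
Proof. by move=> _ A mA; exists A. Qed.

Lemma measurable_complex_of_pair : measurable_fun setT complex_of_pair.
Proof.
move=> _ A [B mB <-]; rewrite !setTI.
by rewrite (_ : _ @^-1` _ = B)//; apply/seteqP; split=> -[].
Qed.

HB.instance Definition _ := isMeasurableFun.Build _ _ _ _ complex_of_pair
  measurable_complex_of_pair.

Lemma measurable_Re : measurable_fun setT (@complex.Re R).
Proof.
have /measurable_fun_pairP[mRe _] := measurable_pair_of_complex.
exact: mRe.
Qed.

Lemma measurable_Im : measurable_fun setT (@complex.Im R).
Proof.
have /measurable_fun_pairP[_ mIm] := measurable_pair_of_complex.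
exact: mIm.
Qed.

Lemma measurable_complexP d (T : measurableType d) (f : T -> R[i]) :
  measurable_fun setT (@complex.Re R \o f) ->
  measurable_fun setT (@complex.Im R \o f) -> measurable_fun setT f.
Proof.
move=> mRe mIm _ A [B mB <-]; rewrite !setTI.
have /(_ measurableT B mB) : measurable_fun setT (pair_of_complex \o f).
  by apply/measurable_fun_pairP; split.
by rewrite setTI.
Qed.

End complex_measurable.

Section iid.
Context d (T : measurableType d) (R : realType).

Definition tuple_cons n (p : T * n.-tuple T) : n.+1.-tuple T := cons_tuple p.1 p.2.

Lemma measurable_tuple_cons n : measurable_fun setT (@tuple_cons n).
Proof. exact: measurable_cons. Qed.

HB.instance Definition _ n := isMeasurableFun.Build _ _ _ _ (@tuple_cons n)
  (@measurable_tuple_cons n).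

Fixpoint iid (P : probability T R) n : probability (n.-tuple T) R :=
  if n is n'.+1 then distribution (P \x iid P n')%E (@tuple_cons n')
  else dirac [tuple].

End iid.

Section covariance.
Context {C : numClosedFieldType} {N : nat}.
Implicit Type S : 'M[C]_N.

Definition covariance_mx S : Prop :=
  S \is hermsymmx /\ forall v : 'cV[C]_N, 0 <= (v ^t* *m S *m v) 0 0.

Definition cov_factor S : 'M[C]_N :=
  invmx (spectralmx S) *m diag_mx (map_mx sqrtC (spectral_diag S)).

Lemma cov_factorK S : covariance_mx S -> cov_factor S *m (cov_factor S) ^t* = S.
Proof.
move=> [Sh Spos].
have /orthomx_spectralP /= := hermitian_normalmx Sh.
have := spectral_unitarymx S; rewrite /cov_factor.
move: (spectralmx S) (spectral_diag S) => U d uU; rewrite invmx_unitary// => SE.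
have UU : U *m U ^t* = 1%:M by exact/unitarymxP.
have adjK m n (M : 'M[C]_(m, n)) : (M ^t*) ^t* = M.
  by apply/matrixP => i j; rewrite !mxE conjCK.
have d_ge0 j : 0 <= d 0 j.
  have := Spos (U ^t* *m delta_mx j 0).
  rewrite trmx_mul map_mxM adjK trmx_delta map_delta_mx SE !mulmxA.
  rewrite -(mulmxA (delta_mx 0 j)) UU mulmx1.
  rewrite -(mulmxA (delta_mx 0 j *m diag_mx d)) UU mulmx1.
  by rewrite -rowE -colE !mxE eqxx mulr1n.
rewrite trmx_mul map_mxM adjK tr_diag_mx map_diag_mx [RHS]SE !mulmxA.
rewrite -(mulmxA (U ^t*)) mulmx_diag; congr (_ *m diag_mx _ *m _).
apply/rowP => j; rewrite !mxE.
rewrite -[RHS]sqrtCK expr2; congr (_ * _).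
by apply: geC0_conj; rewrite sqrtC_ge0.
Qed.

End covariance.

Section gaussian.
Context {R : realType}.

(* CN(0, 1): independent real and imaginary parts, each N(0, 1/2);
   the second argument of [normal_prob] is the standard deviation. *)
Definition cn_std : probability R[i] R :=
  distribution
    (normal_prob 0 (Num.sqrt 2^-1) \x normal_prob 0 (Num.sqrt 2^-1))%E
    (@complex_of_pair R).

Variable N : nat.
Implicit Types A S : 'M[R[i]]_N.

Definition lin_tuple A (w : N.-tuple R[i]) : N.-tuple R[i] :=
  [tuple \sum_j A i j * tnth w j | i < N].

Lemma measurable_lin_tuple A : measurable_fun setT (lin_tuple A).
Proof.
apply/measurable_fun_tnthP => i.
pose re j (w : N.-tuple R[i]) := complex.Re (tnth w j).
pose im j (w : N.-tuple R[i]) := complex.Im (tnth w j).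
have mre j : measurable_fun setT (re j).
  exact: measurableT_comp measurable_Re (measurable_tnth j).
have mim j : measurable_fun setT (im j).
  exact: measurableT_comp measurable_Im (measurable_tnth j).
apply: measurable_complexP.
- rewrite (_ : _ \o _ = fun w => \sum_j
      (complex.Re (A i j) * re j w - complex.Im (A i j) * im j w)).
    apply: measurable_sum => j.
    by apply: measurable_funB; apply: measurable_funM.
  apply/funext => w /=; rewrite tnth_mktuple raddf_sum.
  by apply: eq_bigr => j _; rewrite /re /im; case: (A i j) (tnth w j) => ? ? [].
- rewrite (_ : _ \o _ = fun w => \sum_j
      (complex.Re (A i j) * im j w + complex.Im (A i j) * re j w)).
    apply: measurable_sum => j.
    by apply: measurable_funD; apply: measurable_funM.
  apply/funext => w /=; rewrite tnth_mktuple raddf_sum.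
  by apply: eq_bigr => j _; rewrite /re /im; case: (A i j) (tnth w j) => ? ? [].
Qed.

HB.instance Definition _ A := isMeasurableFun.Build _ _ _ _ (lin_tuple A)
  (measurable_lin_tuple A).

(* law of [F w], where [F F^* = S] (see [cov_factorK]) and the entries of [w]
   are iid CN(0, 1) *)
Definition cn_law S : probability (N.-tuple R[i]) R :=
  distribution (iid cn_std N) (lin_tuple (cov_factor S)).

Definition mean_distortion
    (J : probability (N.-tuple R[i] * N.-tuple R[i])%type R) : \bar R :=
  (\int[J]_h (N%:R^-1 * \sum_(m < N)
     (complex.Re (tnth h.1 m - tnth h.2 m) ^+ 2 +
      complex.Im (tnth h.1 m - tnth h.2 m) ^+ 2))%:E)%E.

Definition rate_distortion (P : probability (N.-tuple R[i]) R) (D : R) : \bar R :=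
  ((N%:R^-1)%:E * ereal_inf
    [set mutual_information (joint_law P k) |
       k in [set k : R.-pker (N.-tuple R[i]) ~> (N.-tuple R[i]) |
               mean_distortion (joint_law P k) <= D%:E]])%E.

End gaussian.

Section allocation.
Context {R : realType} {K : nat}.
Implicit Types (prior Dc : 'I_K -> R) (rate : 'I_K -> R -> \bar R).

Definition feasible prior (D : R) : set ('I_K -> R) :=
  [set Dc | (forall c, 0 <= Dc c) /\ \sum_c prior c * Dc c <= D].

Definition average_rate prior rate Dc : \bar R :=
  (\sum_c (prior c)%:E * rate c (Dc c))%E.

Definition conditional_rate prior rate (D : R) : \bar R :=
  ereal_inf [set average_rate prior rate Dc | Dc in feasible prior D].

Definition optimal_allocation prior rate (D : R) Dc : Prop :=
  feasible prior D Dc /\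
  forall Dc', feasible prior D Dc' ->
    (average_rate prior rate Dc <= average_rate prior rate Dc')%E.

End allocation.

Section waterfilling.
Context {R : realType}.

Definition log2_ratio_pos (lam mu : R) : \bar R :=
  if lam <= mu then 0%E
  else if mu == 0 then +oo%E
  else (Num.max (log2 (lam / mu)) 0)%:E.

Variable N : nat.
Implicit Type lam : 'I_N -> R.

Definition waterfill_rate lam (mu : R) : \bar R :=
  ((N%:R^-1)%:E * \sum_(m < N) log2_ratio_pos (lam m) mu)%E.

Definition waterfill_distortion lam (mu : R) : R :=
  N%:R^-1 * \sum_(m < N) Num.min (lam m) mu.

End waterfilling.

(* Main.v *)
Require Import Defs.
From HB Require Import structures.
From mathcomp Require Import all_boot all_order all_algebra.
From mathcomp Require Import spectral sesquilinear.
From mathcomp Require Import all_classical all_reals all_analysis.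
From mathcomp Require Import measurable_realfun ring lra.
From mathcomp.real_closed Require Import complex.

Set Implicit Arguments.
Unset Strict Implicit.
Unset Printing Implicit Defensive.

Import Order.TTheory GRing.Theory Num.Theory.
Local Open Scope ring_scope.
Local Open Scope complex_scope.

(** Diagonalize R_c by a unitary change of coordinates and fix a water level
    mu > 0.  In the eigencoordinates h'_j of h and y'_j of the reconstruction put
      g(h, y) = prod_j (M_j / mu) exp(|h'_j|^2 / M_j - |h'_j - y'_j|^2 / mu),
    with M_j = max(lambda_j, mu).  A Gaussian integral gives E g(h, y) <= 1 for
    every y, so Gibbs' inequality bounds the mutual information of any joint law
    below by the mean of log2 g, which only depends on the distortion D and is
    the line of slope - 1 / (mu ln 2) tangent to the curve at water level mu.
    Conversely g is itself the density of a transition kernel, with respect to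
    the law of independent y'_j ~ CN(0, M_j - mu), and that kernel attains the
    bound.

    With a common water level all these tangents have the same slope, so any
    allocation of the same total distortion costs at least as much; it costs
    strictly more when some D_c is not the point of contact, because a slightly
    different water level gives a tangent lying above the first one there. *)

(** * Densities and lower bounds on the Kullback-Leibler divergence *)

Section density.
Local Open Scope classical_set_scope.
Local Open Scope ereal_scope.
Context d (T : measurableType d) (R : realType).
Implicit Types P Q : probability T R.

(** The integral is the difference of the integrals of the positive and negative parts, which move
    in opposite directions. This covers infinite integrals, which do occur in [kl_divergence_ge]. *)
Lemma le_integralT P (f g : T -> \bar R) :
  measurable_fun setT f -> measurable_fun setT g ->
  (forall x, f x <= g x) -> \int[P]_x f x <= \int[P]_x g x.
Proof.
move=> mf mg fg; rewrite integralE [leRHS]integralE leeB//.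
- apply: ge0_le_integral => //; [exact: measurable_funepos..|].
  by move=> x _; apply: (@funepos_le _ _ setT); rewrite ?inE.
- apply: ge0_le_integral => //; [exact: measurable_funeneg..|].
  by move=> x _; apply: (@funeneg_le _ _ setT); rewrite ?inE.
Qed.

Lemma density_dominates P (Q : {sigma_finite_measure set T -> \bar R}) (g : T -> \bar R) : measurable_fun setT g ->
  (forall A, measurable A -> P A = \int[Q]_(x in A) g x) -> P `<< Q.
Proof.
move=> mg Pg; apply/null_content_dominatesP => A mA QA0.
by rewrite Pg//; apply: null_set_integral => //; exact: measurable_funTS.
Qed.

Lemma ae_eq_density P (Q : {sigma_finite_measure set T -> \bar R}) (g : T -> R) : measurable_fun setT g ->
  (forall A, measurable A -> P A = \int[Q]_(x in A) (g x)%:E) ->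
  ae_eq Q setT (Radon_Nikodym_SigmaFinite.f P Q) (fun x => (g x)%:E).
Proof.
move=> mg Pg; have mEg : measurable_fun setT (fun x => (g x)%:E).
  exact/measurable_EFinP.
have PQ : P `<< Q by exact: density_dominates Pg.
apply: integral_ae_eq => //; first exact: Radon_Nikodym_SigmaFinite.f_integrable.
by move=> A _ mA; rewrite -Pg// -Radon_Nikodym_SigmaFinite.f_integral.
Qed.

Lemma ge0_integral_density P (Q : {sigma_finite_measure set T -> \bar R})
    (g : T -> R) (f : T -> \bar R) :
  measurable_fun setT g ->
  (forall A, measurable A -> P A = \int[Q]_(x in A) (g x)%:E) ->
  measurable_fun setT f -> (forall x, 0 <= f x) ->
  \int[P]_x f x = \int[Q]_x (f x * (g x)%:E).
Proof.
move=> mg Pg mf f0; have mEg : measurable_fun setT (fun x => (g x)%:E).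
  exact/measurable_EFinP.
have PQ : P `<< Q by exact: density_dominates Pg.
rewrite -(Radon_Nikodym_SigmaFinite.change_of_variables PQ)//.
apply: ae_eq_integral => //.
- apply: emeasurable_funM => //.
  exact: measurable_int (Radon_Nikodym_SigmaFinite.f_integrable PQ).
- exact: emeasurable_funM.
- exact/ae_eqe_mul2l/ae_eq_density.
Qed.

Lemma measurable_log2 : measurable_fun setT (@log2 R).
Proof. exact: measurable_funM. Qed.

(** The two versions of the derivative agree [Q]-almost everywhere, hence [P]-almost everywhere. The
    one on the right is nonnegative and finite at every point and comes with a change of
    variables. *)
Lemma kl_divergence_RN P Q : P `<< Q ->
  kl_divergence P Q =
  \int[P]_x (log2 (fine (Radon_Nikodym_SigmaFinite.f P Q x)))%:E.
Proof.
move=> PQ; rewrite /kl_divergence; case: pselect => // PQ'.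
apply: ae_eq_integral => //.
- apply/measurable_EFinP/measurableT_comp; first exact: measurable_log2.
  by apply: measurableT_comp => //.
- apply/measurable_EFinP/measurableT_comp; first exact: measurable_log2.
  apply: measurableT_comp => //.
  exact: measurable_int (Radon_Nikodym_SigmaFinite.f_integrable PQ).
- apply: (null_dominates_ae_eq _ PQ) => //.
  have := ae_eq_Radon_Nikodym_SigmaFinite PQ measurableT.
  by apply: filterS => x /[apply] ->.
Qed.

Lemma kl_divergence_density P Q (g : T -> R) : measurable_fun setT g ->
  (forall A, measurable A -> P A = \int[Q]_(x in A) (g x)%:E) ->
  kl_divergence P Q = \int[P]_x (log2 (g x))%:E.
Proof.
move=> mg Pg; have mEg : measurable_fun setT (fun x => (g x)%:E).
  exact/measurable_EFinP.
have PQ : P `<< Q by exact: density_dominates Pg.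
rewrite kl_divergence_RN//; apply: ae_eq_integral => //.
- apply/measurable_EFinP/measurableT_comp; first exact: measurable_log2.
  apply: measurableT_comp => //.
  exact: measurable_int (Radon_Nikodym_SigmaFinite.f_integrable PQ).
- by apply/measurable_EFinP/measurableT_comp => //; exact: measurable_log2.
- apply: (null_dominates_ae_eq _ PQ) => //.
  by have := ae_eq_density mg Pg; apply: filterS => x /[apply] ->.
Qed.

(* Gibbs' inequality in Donsker-Varadhan form: [ln f >= ln g - g / f + 1] for
   [f = dP/dQ], and [g / f] has [P]-integral at most [\int[Q] g]. *)
Lemma kl_divergence_ge P Q (g : T -> R) : measurable_fun setT g ->
  (forall x, 0 < g x)%R -> P.-integrable setT (fun x => (log2 (g x))%:E) ->
  \int[Q]_x (g x)%:E <= 1 ->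
  \int[P]_x (log2 (g x))%:E <= kl_divergence P Q.
Proof.
move=> mg g0 ig g1.
have [PQ|nPQ] := pselect (P `<< Q); last first.
  by rewrite /kl_divergence; case: pselect => [/nPQ//|?]; rewrite leey.
rewrite kl_divergence_RN//.
pose F := Radon_Nikodym_SigmaFinite.f P Q.
have F0 x : 0 <= F x by exact: Radon_Nikodym_SigmaFinite.f_ge0.
have Ffin x : F x \is a fin_num by exact: Radon_Nikodym_SigmaFinite.f_fin_num.
have mF : measurable_fun setT F.
  exact: measurable_int (Radon_Nikodym_SigmaFinite.f_integrable PQ).
pose f x := fine (F x); have fE x : F x = (f x)%:E by rewrite fineK.
have f0 x : (0 <= f x)%R by rewrite -lee_fin -fE.
have mf : measurable_fun setT f by apply: measurableT_comp => //.
have mf0 : measurable [set x | (0 < f x)%R].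
  rewrite -[X in measurable X]setTI; have -> : [set x | (0 < f x)%R] = f @^-1` `]0%R, +oo[.
    by apply/seteqP; split => x /=; rewrite in_itv/= andbT.
  exact: mf.
(* [r] is g / f, set to 0 where f vanishes; the exponential form makes its measurability
   immediate. *)
pose r x := (if 0 < f x then expR (ln (g x) - ln (f x)) else 0)%R.
have rE x : (0 < f x)%R -> (r x = g x / f x)%R.
  by move=> fx; rewrite /r fx -ln_div ?posrE// lnK// posrE divr_gt0.
have mr : measurable_fun setT r.
  apply: measurable_fun_ifT => //; first exact: measurable_fun_ltr.
  apply: measurableT_comp => //.
  by apply: measurable_funB; exact: measurableT_comp (@measurable_ln R) _.
have r0 x : (0 <= r x)%R by rewrite /r; case: ifPn => // _; exact: expR_ge0.
have mEr : measurable_fun setT (fun x => (r x)%:E) by exact/measurable_EFinP.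
have mEg : measurable_fun setT (fun x => (g x)%:E) by exact/measurable_EFinP.
have r1 : \int[P]_x (r x)%:E <= 1.
  rewrite -(Radon_Nikodym_SigmaFinite.change_of_variables PQ)//.
  apply: le_trans g1; apply: ge0_le_integral => //.
  - by move=> x _; apply: mule_ge0; [rewrite lee_fin|exact: F0].
  - exact: emeasurable_funM.
  - move=> x _; rewrite -/F fE -EFinM lee_fin.
    have := f0 x; rewrite le_eqVlt => /predU1P[<-|fx]; first by rewrite mulr0 ltW.
    by rewrite rE// divfK// gt_eqF.
have ir : P.-integrable setT (fun x => (r x)%:E).
  apply/integrableP; split => //.
  under eq_integral do rewrite gee0_abs ?lee_fin//.
  by rewrite (le_lt_trans r1)// ltry.
have l2 : (0 < ln 2 :> R)%R by rewrite ln_gt0// ltr1n.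
pose c : R := (ln 2)^-1%R; have c0 : (0 < c)%R by rewrite invr_gt0.
pose q x := (1 - r x)%R.
have iq : P.-integrable setT (fun x => (q x)%:E).
  rewrite (_ : (fun x => _) = (cst 1 \- (fun x => (r x)%:E))); last by apply/funext.
  by apply: integrableB => //; exact: finite_measure_integrable_cst.
have q0 : 0 <= \int[P]_x (q x)%:E.
  rewrite (eq_integral (cst 1 \- (fun x => (r x)%:E)))//.
  rewrite integralB//; last exact: finite_measure_integrable_cst.
  rewrite [X in X - _](_ : _ = 1) ?sube_ge0 ?orbT//.
  by rewrite integral_cst// mul1e; exact: probability_setT.
pose h x := (log2 (g x))%:E + c%:E * (q x)%:E.
have ih : P.-integrable setT h by apply: integrableD => //; exact: integrableZl.
have mh := measurable_int _ ih.
(* Where f vanishes, a [P]-null set, log2 f is replaced by [h], so that [h] is below [k] at every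
   point. *)
pose k x := if (0 < f x)%R then (log2 (f x))%:E else h x.
have mlf : measurable_fun setT (fun x => (log2 (f x))%:E).
  by apply/measurable_EFinP/measurableT_comp => //; exact: measurable_log2.
have mk : measurable_fun setT k.
  apply: measurable_fun_ifT => //; exact: measurable_fun_ltr.
have kE : \int[P]_x (log2 (f x))%:E = \int[P]_x k x.
  apply: ae_eq_integral => //; exists (~` [set x | (0 < f x)%R]); split.
  - exact: measurableC.
  - apply: etrans (Radon_Nikodym_SigmaFinite.f_integral PQ (measurableC mf0)) _.
    apply: integral0_eq => x /negP; rewrite -leNgt => fx.
    by apply/eqP; rewrite eq_le F0 -/F fE lee_fin fx.
  - by apply: subsetC => x /= fx _; rewrite /k fx.
rewrite [leRHS]kE; apply: (@le_trans _ _ (\int[P]_x h x)).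
  rewrite integralD//; last exact: integrableZl.
  by rewrite integralZl// leeDl// mule_ge0// lee_fin ltW.
apply: le_integralT => // x; rewrite /k; case: ifPn => // fx.
rewrite /h -EFinM -EFinD lee_fin /log2 mulrC (mulrC (ln (f x))) -mulrDr ler_pM2l//.
have gf : (0 < g x / f x)%R by rewrite divr_gt0.
have := @le_ln1Dx _ (g x / f x - 1)%R; rewrite addrCA subrr addr0 ltrBrDr addrC subrr.
by rewrite ln_div ?posrE// /q rE// => /(_ gf); lra.
Qed.

End density.

(** * Marginals of a joint law and the lower bound on mutual information *)

Section joint_law.
Local Open Scope classical_set_scope.
Local Open Scope ereal_scope.
Context d1 d2 (X : measurableType d1) (Y : measurableType d2) (R : realType).
Implicit Types (P : probability X R) (Q : probability Y R).

Lemma distribution_fst_joint_law P (k : R.-pker X ~> Y) A : measurable A ->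
  distribution (joint_law P k) (@fst X Y) A = P A.
Proof.
move=> mA; rewrite /distribution/= /pushforward/= /joint_law.
transitivity (\int[P]_x (\1_A x)%:E); last by rewrite integral_indic// setIT.
apply: eq_integral => x _; rewrite indicE.
have [xA|xA] := boolP (x \in A).
  rewrite (_ : xsection _ _ = setT) ?prob_kernel//.
  by apply/seteqP; split => y //= _; rewrite /xsection/= inE/=; rewrite inE in xA.
rewrite (_ : xsection _ _ = set0) ?measure0//.
by apply/seteqP; split => y //=; rewrite /xsection/= inE/= => /mem_set; rewrite (negbTE xA).
Qed.

Lemma product_measure_eq (P P' : probability X R) (Q Q' : probability Y R) :
  (forall A, measurable A -> P A = P' A) ->
  (forall A, measurable A -> Q A = Q' A) ->
  forall A, measurable A -> (P \x Q) A = (P' \x Q') A.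
Proof.
move=> PP QQ A mA; rewrite /product_measure1/=.
rewrite (eq_measure_integral P'); last by move=> B mB _; exact: PP.
by apply: eq_integral => x _ /=; apply: QQ; exact: measurable_xsection.
Qed.

(* The product bound only needs the first marginal to be [P]; the second one is
   arbitrary, whence the hypothesis for every [y]. *)
Lemma mutual_information_ge P (k : R.-pker X ~> Y) (g : X * Y -> R) :
  measurable_fun setT g -> (forall z, 0 < g z)%R ->
  (joint_law P k).-integrable setT (fun z => (log2 (g z))%:E) ->
  (forall y, \int[P]_x (g (x, y))%:E <= 1) ->
  \int[joint_law P k]_z (log2 (g z))%:E <= mutual_information (joint_law P k).
Proof.
move=> mg g0 ig g1; apply: kl_divergence_ge => //.
have mEg : measurable_fun setT (fun z => (g z)%:E) by exact/measurable_EFinP.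
rewrite fubini_tonelli2//; last by move=> z; rewrite lee_fin ltW.
apply: (@le_trans _ _ (\int[distribution (joint_law P k) (@snd X Y)]_y (cst 1) y)).
  apply: ge0_le_integral => //.
  - by move=> y _; apply: integral_ge0 => x _; rewrite lee_fin ltW.
  - apply: measurable_fun_fubini_tonelli_G => // z; first by rewrite lee_fin ltW.
  - move=> y _; rewrite /fubini_G (eq_measure_integral P)//.
    by move=> A mA _; exact: distribution_fst_joint_law.
rewrite integral_cst// mul1e.
exact: (probability_le1 (distribution (joint_law P k) (@snd X Y)) measurableT).
Qed.

End joint_law.

(** * Transition kernels given by a density *)

Section density_kernel.
Local Open Scope classical_set_scope.
Local Open Scope ereal_scope.
Context d1 d2 (X : measurableType d1) (Y : measurableType d2) (R : realType).
Variables (P : probability X R) (Q : probability Y R) (g : X * Y -> R).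
Hypotheses (mg : measurable_fun setT g) (g0 : forall z, (0 <= g z)%R).
Hypothesis g1 : forall x, \int[Q]_y (g (x, y))%:E = 1.

Let mEg : measurable_fun setT (fun z => (g z)%:E).
Proof. exact/measurable_EFinP. Qed.

Let mEg2 x : measurable_fun setT (fun y => (g (x, y))%:E).
Proof. exact: measurableT_comp mEg (measurable_pair1 x). Qed.

Let kd x (A : set Y) := \int[Q]_(y in A) (g (x, y))%:E.

Let kd0 x : kd x set0 = 0.
Proof. exact: integral_set0. Qed.

Let kd_ge0 x A : 0 <= kd x A.
Proof. by apply: integral_ge0 => y _; rewrite lee_fin. Qed.

Let kd_sigma_additive x : semi_sigma_additive (kd x).
Proof.
move=> F mF tF mUF; rewrite /kd ge0_integral_bigcup//=.
- apply: is_cvg_ereal_nneg_natsum_cond => n _ _.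
  by apply: integral_ge0 => y _; rewrite lee_fin.
- exact: measurable_funTS.
- by move=> y _; rewrite lee_fin.
Qed.

HB.instance Definition _ x := isMeasure.Build _ _ _ (kd x)
  (kd0 x) (kd_ge0 x) (@kd_sigma_additive x).

Let kdm x : {measure set Y -> \bar R} := kd x.

Let mkd A : measurable A -> measurable_fun setT (kdm ^~ A).
Proof.
move=> mA.
pose h z := (g z * \1_A z.2)%:E.
have -> : kdm ^~ A = fubini_F Q h.
  apply/funext => x; rewrite /kdm/= /kd integral_mkcond /fubini_F.
  apply: eq_integral => y _; rewrite /h/= patchE indicE.
  by case: ifPn => _; rewrite ?mulr1 ?mulr0.
apply: measurable_fun_fubini_tonelli_F; last by move=> z; rewrite lee_fin mulr_ge0.
apply/measurable_EFinP/measurable_funM => //.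
by apply: measurableT_comp => //; exact: measurable_indic.
Qed.

HB.instance Definition _ := isKernel.Build _ _ _ _ _ kdm mkd.

Let kd1 x : kdm x setT = 1.
Proof. exact: g1. Qed.

HB.instance Definition _ := Kernel_isProbability.Build _ _ _ _ _ kdm kd1.

Definition density_kernel : R.-pker X ~> Y := kdm.

Let J := joint_law P density_kernel.

Lemma joint_law_density A : measurable A -> J A = \int[P \x Q]_(z in A) (g z)%:E.
Proof.
move=> mA; rewrite integral_mkcond fubini_tonelli1; last first.
- by apply: erestrict_ge0 => z _; rewrite lee_fin.
- by apply/(measurable_restrictT _ _).1 => //; exact: measurable_funTS.
rewrite /J /joint_law/=; apply: eq_integral => x _.
rewrite /kd integral_mkcond /fubini_F; apply: eq_integral => y _.
by rewrite !patchE mem_xsection.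
Qed.

Lemma ge0_integral_joint_law_density (f : X * Y -> \bar R) :
  measurable_fun setT f -> (forall z, 0 <= f z) ->
  \int[J]_z f z = \int[P \x Q]_z (f z * (g z)%:E).
Proof.
move=> mf f0; apply: (@ge0_integral_density _ _ _ J
  ((P \x Q) : probability (X * Y)%type R)) => //.
exact: joint_law_density.
Qed.

(** Consistency of the channel: fed with [P], the kernel has output law [Q]. *)
Hypothesis g2 : forall A, measurable A ->
  \int[Q]_(y in A) \int[P]_x (g (x, y))%:E = Q A.

Lemma distribution_snd_joint_law_density A : measurable A ->
  distribution J (@snd X Y) A = Q A.
Proof.
move=> mA; rewrite -[LHS]/(J (snd @^-1` A)) joint_law_density; last first.
  by rewrite -[X in measurable X]setTI; exact: measurable_snd.
rewrite integral_mkcond fubini_tonelli2; last first.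
- by apply: erestrict_ge0 => z _; rewrite lee_fin.
- apply/(measurable_restrictT _ _).1; last exact: measurable_funTS.
  by rewrite -[X in measurable X]setTI; exact: measurable_snd.
rewrite -g2// [in RHS]integral_mkcond; apply: eq_integral => y _.
rewrite /fubini_G patchE; case: ifPn => yA.
  apply: eq_integral => x _; rewrite patchE ifT// inE/=; by rewrite inE in yA.
apply: integral0_eq => x _; rewrite patchE ifF//; apply/negbTE; apply: contra yA.
by rewrite !inE.
Qed.

(** The marginals of [J] are [P] and [Q], so [g] is the density of [J] with respect to the product
    of its own marginals. *)
Lemma mutual_information_density :
  mutual_information J = \int[J]_z (log2 (g z))%:E.
Proof.
apply: kl_divergence_density => // A mA.
apply: etrans (joint_law_density mA) _.
apply: eq_measure_integral => B mB _; apply: product_measure_eq => // C mC.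
- exact/esym/distribution_fst_joint_law.
- exact/esym/distribution_snd_joint_law_density.
Qed.

End density_kernel.

(** * Gaussian integrals of exponentials of quadratics *)

Section gaussian_integrals.
Context {R : realType}.
Implicit Types (a b : R) (z y c : R[i]).
Local Open Scope classical_set_scope.

(** Completing the square turns the integrand times the N(0, 1/2) density into a constant times the
    normal density of mean b / (1 + a) and variance 1 / (2 (1 + a)). *)
Lemma normal_exp_quadratic a b : -1 < a ->
  (\int[normal_prob 0 (Num.sqrt 2^-1)]_x (expR (- a * x ^+ 2 + 2 * b * x))%:E =
   ((Num.sqrt (1 + a))^-1 * expR (b ^+ 2 / (1 + a)))%:E)%E.
Proof.
move=> a1; have a0 : 0 < 1 + a by lra.
pose s := Num.sqrt (2 * (1 + a))^-1.
have s2 : s ^+ 2 *+ 2 = (1 + a)^-1.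
  rewrite sqr_sqrtr ?invr_ge0; last by rewrite mulr_ge0// ltW.
  by rewrite -mulr_natr; field; rewrite gt_eqF.
have s0 : s != 0 by rewrite gt_eqF// sqrtr_gt0 invr_gt0 mulr_gt0.
have h2 : Num.sqrt (2^-1 : R) ^+ 2 *+ 2 = 1.
  by rewrite sqr_sqrtr ?invr_ge0// -mulr_natr; field.
have h0 : Num.sqrt (2^-1 : R) != 0 by rewrite gt_eqF// sqrtr_gt0 invr_gt0.
have pdfE m (t v x : R) : t != 0 -> t ^+ 2 *+ 2 = v ->
    normal_pdf m t x = (Num.sqrt (v * pi))^-1 * expR (- (x - m) ^+ 2 / v).
  by move=> t0 <-; rewrite /normal_pdf (negbTE t0) /normal_peak /normal_fun mulrnAl.
rewrite (@ge0_integral_density _ _ _ _ lebesgue_measure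
  (normal_pdf 0 (Num.sqrt 2^-1)))//.
- under eq_integral => x _ do rewrite -EFinM.
  pose C := (Num.sqrt (1 + a))^-1 * expR (b ^+ 2 / (1 + a)).
  have C0 : 0 <= C by rewrite mulr_ge0 ?invr_ge0 ?expR_ge0.
  rewrite (eq_integral (fun x : measurableTypeR R => (C%:E * (normal_pdf (b / (1 + a)) s x)%:E)%E)).
    rewrite ge0_integralZl_EFin ?integral_normal_pdf ?mule1//.
    - by move=> x _; rewrite lee_fin normal_pdf_ge0.
    - by apply/measurable_EFinP; exact: measurable_normal_pdf.
  move=> x _; rewrite -EFinM; congr EFin.
  rewrite (pdfE _ _ _ _ s0 s2) (pdfE _ _ _ _ h0 h2) mul1r /C.
  have -> : Num.sqrt ((1 + a)^-1 * pi) = (Num.sqrt (1 + a))^-1 * Num.sqrt pi :> R.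
    by rewrite sqrtrM ?invr_ge0 ?(ltW a0)// sqrtrV// ltW.
  have sa : Num.sqrt (1 + a) != 0 by rewrite gt_eqF// sqrtr_gt0.
  have sp : Num.sqrt pi != 0 :> R by rewrite gt_eqF// sqrtr_gt0 pi_gt0.
  transitivity ((Num.sqrt pi)^-1 *
    (expR (- a * x ^+ 2 + 2 * b * x) * expR (- (x - 0) ^+ 2 / 1))); first by ring.
  transitivity ((Num.sqrt pi)^-1 * (expR (b ^+ 2 / (1 + a)) *
     expR (- (x - b / (1 + a)) ^+ 2 / (1 + a)^-1))); last by field; rewrite sa sp.
  congr (_ * _); rewrite -!expRD; congr expR; field; rewrite gt_eqF//.
- exact: measurable_normal_pdf.
- apply/measurable_EFinP/measurableT_comp => //.
  by apply: measurable_funD; apply: measurable_funM.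
Qed.

(** Squared modulus with values in [R], in the form that occurs in [mean_distortion]. *)
Definition nrm2 z : R := complex.Re z ^+ 2 + complex.Im z ^+ 2.

Lemma nrm2_ge0 z : 0 <= nrm2 z.
Proof. by rewrite addr_ge0// sqr_ge0. Qed.

Lemma measurable_nrm2 : measurable_fun setT nrm2.
Proof.
by apply: measurable_funD; apply: measurable_funX;
  [exact: measurable_Re|exact: measurable_Im].
Qed.

(** Real and imaginary parts are independent, so this is a product of two one-dimensional
    integrals. *)
Lemma cn_std_exp_quadratic a b : -1 < a -> forall b',
  (\int[cn_std]_z (expR (- a * nrm2 z + 2 * (b * complex.Re z + b' * complex.Im z)))%:E =
   ((1 + a)^-1 * expR ((b ^+ 2 + b' ^+ 2) / (1 + a)))%:E)%E.
Proof.
move=> a1 b'; have a0 : 0 < 1 + a by lra.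
have mf : measurable_fun setT (fun z => (expR (- a * nrm2 z +
    2 * (b * complex.Re z + b' * complex.Im z)))%:E).
  apply/measurable_EFinP/measurableT_comp => //.
  apply: measurable_funD; apply: measurable_funM => //.
    exact: measurable_nrm2.
  by apply: measurable_funD; apply: measurable_funM => //;
    [exact: measurable_Re|exact: measurable_Im].
rewrite ge0_integral_pushforward//= preimage_setT.
rewrite fubini_tonelli1//=; last first.
  exact: measurableT_comp mf measurable_complex_of_pair.
have mE (u v : R) : measurable_fun setT
    (fun x : measurableTypeR R => (expR (- u * x ^+ 2 + 2 * v * x))%:E).
  apply/measurable_EFinP/measurableT_comp => //.
  by apply: measurable_funD; apply: measurable_funM.
rewrite (eq_integral (fun x : measurableTypeR R =>
  (((Num.sqrt (1 + a))^-1 * expR (b' ^+ 2 / (1 + a)))%:E *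
    (expR (- a * x ^+ 2 + 2 * b * x))%:E)%E)); last first.
  move=> x _; rewrite /fubini_F/= /nrm2/=.
  rewrite (eq_integral (fun y : measurableTypeR R =>
   ((expR (- a * x ^+ 2 + 2 * b * x))%:E * (expR (- a * y ^+ 2 + 2 * b' * y))%:E)%E)).
    rewrite ge0_integralZl_EFin ?expR_ge0// normal_exp_quadratic// muleC//.
  by move=> y _; rewrite -EFinM -expRD; congr (expR _)%:E; ring.
rewrite ge0_integralZl_EFin ?mulr_ge0 ?invr_ge0 ?expR_ge0//.
rewrite normal_exp_quadratic// -EFinM; congr EFin.
have sq : (Num.sqrt (1 + a))^-1 * (Num.sqrt (1 + a))^-1 = (1 + a)^-1.
  by rewrite -invfM -expr2 sqr_sqrtr// ltW.
rewrite mulrDl expRD -sq; ring.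
Qed.

End gaussian_integrals.

(** * Integrals of products over independent coordinates *)

Section iid_integral.
Local Open Scope classical_set_scope.
Context d (T : measurableType d) (R : realType).
Implicit Types (P : probability T R).

Lemma ge0_integral_iid_prod P n (f : 'I_n -> T -> R) (c : 'I_n -> R) :
  (forall i, measurable_fun setT (f i)) -> (forall i x, 0 <= f i x) ->
  (forall i, \int[P]_x (f i x)%:E = (c i)%:E)%E ->
  (\int[iid P n]_w (\prod_(i < n) f i (tnth w i))%:E = (\prod_(i < n) c i)%:E)%E.
Proof.
elim: n f c => [|n IH] f c mf f0 fc.
  rewrite (eq_integral (cst 1%E)); last by move=> w _; rewrite big_ord0.
  by rewrite integral_cst// mul1e big_ord0; exact: probability_setT.
have mprod m (h : 'I_m -> T -> R) : (forall i, measurable_fun setT (h i)) ->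
    measurable_fun setT (fun w : m.-tuple T => (\prod_(i < m) h i (tnth w i))%:E).
  move=> mh; apply/measurable_EFinP; apply: measurable_prod => i _.
  exact: measurableT_comp (mh i) (measurable_tnth i).
rewrite ge0_integral_pushforward//=; last 2 first.
- exact: mprod.
- by move=> w _; rewrite lee_fin prodr_ge0.
rewrite preimage_setT fubini_tonelli1//=; last 2 first.
- exact: measurableT_comp (mprod _ _ mf) (@measurable_tuple_cons _ T n).
- by move=> w; rewrite lee_fin prodr_ge0.
transitivity (\int[P]_x ((\prod_(i < n) c (lift ord0 i))%:E * (f ord0 x)%:E))%E.
  apply: eq_integral => x _; rewrite /fubini_F/= muleC.
  rewrite -(IH (fun i => f (lift ord0 i)))// -ge0_integralZl_EFin//; last 2 first.
  - by move=> w _; rewrite lee_fin prodr_ge0.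
  - exact: (mprod _ (fun i => f (lift ord0 i))).
  apply: eq_integral => w _; rewrite -EFinM big_ord_recl; congr (_ * _)%:E.
  by apply: eq_bigr => i _; rewrite tnthS.
rewrite ge0_integralZl_EFin//; last 3 first.
- by move=> x _; rewrite lee_fin.
- exact/measurable_EFinP.
- rewrite prodr_ge0// => i _; rewrite -lee_fin -fc integral_ge0// => x _.
  by rewrite lee_fin.
by rewrite fc -EFinM big_ord_recl mulrC.
Qed.

End iid_integral.

(** * The Gaussian test channel in one complex dimension *)

Section scalar_channel.
Context {R : realType}.
Implicit Types (e mu tau : R) (c t h y z w : R[i]).
Local Open Scope classical_set_scope.

Lemma nrm2M c z : nrm2 (c * z) = nrm2 c * nrm2 z :> R.
Proof. by case: c z => [? ?] [? ?]; rewrite /nrm2/=; ring. Qed.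

Lemma nrm2_distC h y : nrm2 (h - y) = nrm2 (y - h) :> R.
Proof. by case: h y => [? ?] [? ?]; rewrite /nrm2/=; ring. Qed.

Lemma measurable_complexZ c : measurable_fun setT (fun w : R[i] => c * w).
Proof.
apply: measurable_complexP.
  rewrite (_ : _ \o _ = fun w => complex.Re c * complex.Re w - complex.Im c * complex.Im w).
    by apply: measurable_funB; apply: measurable_funM => //;
      [exact: measurable_Re|exact: measurable_Im].
  by apply/funext => w /=; case: c w => ? ? [].
rewrite (_ : _ \o _ = fun w => complex.Re c * complex.Im w + complex.Im c * complex.Re w).
  by apply: measurable_funD; apply: measurable_funM => //;
    [exact: measurable_Im|exact: measurable_Re].
by apply/funext => w /=; case: c w => ? ? [].
Qed.

Lemma measurable_complexB d (T : measurableType d) (f g : T -> R[i]) :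
  measurable_fun setT f -> measurable_fun setT g ->
  measurable_fun setT (fun x => f x - g x).
Proof.
move=> mf mg; apply: measurable_complexP.
  rewrite (_ : _ \o _ = fun x => complex.Re (f x) - complex.Re (g x)).
    by apply: measurable_funB; exact: measurableT_comp measurable_Re _.
  by apply/funext => x /=; case: (f x) (g x) => ? ? [].
rewrite (_ : _ \o _ = fun x => complex.Im (f x) - complex.Im (g x)).
  by apply: measurable_funB; exact: measurableT_comp measurable_Im _.
by apply/funext => x /=; case: (f x) (g x) => ? ? [].
Qed.

Lemma cn_std_exp_nrm2 (alpha kappa : R) c y :
  -1 < (kappa - alpha) * nrm2 c ->
  (\int[cn_std]_w (expR (alpha * nrm2 (c * w) - kappa * nrm2 (c * w - y)))%:E =
   ((1 + (kappa - alpha) * nrm2 c)^-1 *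
    expR (kappa ^+ 2 * nrm2 c * nrm2 y / (1 + (kappa - alpha) * nrm2 c)
          - kappa * nrm2 y))%:E)%E.
Proof.
move=> h; set a := (kappa - alpha) * nrm2 c in h *.
(* [b] and [b'] are the real and imaginary parts of kappa times conj(c) y, the linear coefficient in
   w of the expanded exponent. *)
pose b := kappa * (complex.Re c * complex.Re y + complex.Im c * complex.Im y).
pose b' := kappa * (complex.Re c * complex.Im y - complex.Im c * complex.Re y).
rewrite (eq_integral (fun w => ((expR (- kappa * nrm2 y))%:E *
  (expR (- a * nrm2 w + 2 * (b * complex.Re w + b' * complex.Im w)))%:E)%E)); last first.
  move=> w _; rewrite -EFinM -expRD; congr (expR _)%:E.
  rewrite nrm2M /a /b /b'; case: c w y {h a b b'} => [? ?] [? ?] [? ?].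
  by rewrite /nrm2/=; ring.
rewrite ge0_integralZl_EFin ?expR_ge0//; last first.
  apply/measurable_EFinP/measurableT_comp => //.
  apply: measurable_funD; apply: measurable_funM => //; first exact: measurable_nrm2.
  by apply: measurable_funD; apply: measurable_funM => //;
    [exact: measurable_Re|exact: measurable_Im].
rewrite cn_std_exp_quadratic// -EFinM mulrCA -expRD; congr (_ * expR _)%:E.
rewrite addrC mulNr; congr (_ / _ - _).
by rewrite /b /b'; case: c y {h a b b'} => [? ?] [? ?]; rewrite /nrm2/=; ring.
Qed.

(* For [e > mu] this is the density, with respect to the output law
   CN(0, e - mu), of the test channel whose reverse is [h = y + CN(0, mu)];
   for [e <= mu] the output is [0] and the density is [1] there. *)
Definition channel_density e mu h y : R :=
  Num.max e mu / mu * expR (nrm2 h / Num.max e mu - nrm2 (h - y) / mu).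

Lemma measurable_channel_density d (T : measurableType d) e mu (f g : T -> R[i]) :
  measurable_fun setT f -> measurable_fun setT g ->
  measurable_fun setT (fun x => channel_density e mu (f x) (g x)).
Proof.
move=> mf mg; apply: measurable_funM => //; apply: measurableT_comp => //.
apply: measurable_funB; apply: measurable_funM => //;
  apply: measurableT_comp measurable_nrm2 _ => //.
exact: measurable_complexB.
Qed.

Lemma channel_density_gt0 e mu h y : 0 < mu -> 0 < channel_density e mu h y.
Proof. by move=> mu0; rewrite mulr_gt0 ?expR_gt0// divr_gt0// lt_max mu0 orbT. Qed.

(** Given the output y = t z, the error h - y is CN(0, min(e, mu)), so its squared modulus is
    exponential with that mean; the right-hand side is its moment generating function. At tau = 0
    the density has mean 1 in the input. *)
Lemma channel_density_mgf e mu tau c t z : 0 < mu -> nrm2 c = e ->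
  nrm2 t = Num.max e mu - mu -> tau * Num.min e mu < 1 ->
  (\int[cn_std]_w (channel_density e mu (c * w) (t * z) *
      expR (tau * nrm2 (c * w - t * z)))%:E = (1 - tau * Num.min e mu)^-1%:E)%E.
Proof.
move=> mu0 ce te taum.
have M0 : 0 < Num.max e mu by rewrite lt_max mu0 orbT.
rewrite (eq_integral (fun w => ((Num.max e mu / mu)%:E *
  (expR ((Num.max e mu)^-1 * nrm2 (c * w)
    - (mu^-1 - tau) * nrm2 (c * w - t * z)))%:E)%E)); last first.
  move=> w _; rewrite -EFinM; congr EFin.
  by rewrite /channel_density -[LHS]mulrA -expRD; congr (_ * expR _); ring.
have e0 : 0 <= e by rewrite -ce nrm2_ge0.
rewrite ge0_integralZl_EFin ?divr_ge0 ?(ltW M0) ?(ltW mu0)//; last first.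
  apply/measurable_EFinP/measurableT_comp => //.
  apply: measurable_funB; apply: measurable_funM => //;
    apply: measurableT_comp (measurable_nrm2) _; first exact: measurable_complexZ.
  by apply: measurable_complexB => //; exact: measurable_complexZ.
have aE : 1 + (mu^-1 - tau - (Num.max e mu)^-1) * e =
    Num.max e mu / mu * (1 - tau * Num.min e mu).
  case: (leP e mu) => emu; field; rewrite ?gt_eqF//=.
  by rewrite (lt_trans mu0 emu).
have a0 : 0 < 1 + (mu^-1 - tau - (Num.max e mu)^-1) * e.
  by rewrite aE mulr_gt0 ?divr_gt0// subr_gt0.
rewrite cn_std_exp_nrm2 ce; last by move: a0; lra.
rewrite -EFinM nrm2M te aE; congr EFin.
have tm : 1 - tau * Num.min e mu != 0 by rewrite gt_eqF// subr_gt0.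
(* The dependence on the output cancels: for e <= mu the output is 0, otherwise max(e, mu) = e and
   the two coefficients agree. *)
have -> : (mu^-1 - tau) ^+ 2 * e * ((Num.max e mu - mu) * nrm2 z) /
    (Num.max e mu / mu * (1 - tau * Num.min e mu))
    - (mu^-1 - tau) * ((Num.max e mu - mu) * nrm2 z) = 0.
  move: tm; case: (leP e mu) => emu tm; first by rewrite subrr !(mul0r, mulr0) subrr.
  by field; rewrite tm !gt_eqF//= (lt_trans mu0 emu).
by rewrite expR0 mulr1; field; rewrite tm !gt_eqF.
Qed.

(** With M = max(e, mu), the density is the CN(0, mu) density at h - y divided by the CN(0, M)
    density at h; convolving CN(0, M - mu) with CN(0, mu) gives CN(0, M). *)
Lemma channel_density_kernel e mu h t : 0 < mu -> nrm2 t = Num.max e mu - mu ->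
  (\int[cn_std]_z (channel_density e mu h (t * z))%:E = 1)%E.
Proof.
move=> mu0 te; have M0 : 0 < Num.max e mu by rewrite lt_max mu0 orbT.
pose C := Num.max e mu / mu * expR (nrm2 h / Num.max e mu).
have C0 : 0 <= C by rewrite mulr_ge0 ?expR_ge0// divr_ge0 ?ltW.
rewrite (eq_integral (fun z => (C%:E *
    (expR (0 * nrm2 (t * z) - mu^-1 * nrm2 (t * z - h)))%:E)%E)); last first.
  move=> z _; rewrite -EFinM; congr EFin; rewrite /C -[RHS]mulrA -expRD.
  by rewrite /channel_density (nrm2_distC h); congr (_ * expR _); ring.
rewrite ge0_integralZl_EFin//; last first.
  apply/measurable_EFinP/measurableT_comp => //.
  apply: measurable_funB; apply: measurable_funM => //;
    apply: measurableT_comp (measurable_nrm2) _; first exact: measurable_complexZ.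
  by apply: measurable_complexB => //; exact: measurable_complexZ.
have aE : 1 + (mu^-1 - 0) * (Num.max e mu - mu) = Num.max e mu / mu.
  by field; rewrite gt_eqF.
have a0 : 0 < 1 + (mu^-1 - 0) * (Num.max e mu - mu) by rewrite aE divr_gt0.
rewrite cn_std_exp_nrm2 te; last by move: a0; lra.
rewrite aE -EFinM /C; congr EFin; rewrite mulrACA -expRD divff ?mul1r; last first.
  by rewrite gt_eqF// divr_gt0.
by rewrite -expR0; congr expR; field; rewrite !gt_eqF.
Qed.

(** With M = max(e, mu), the integral is exp(- |y|^2 (M - e) / (mu M)): equal to 1 when e >= mu, and
    at most 1 when e < mu. *)
Lemma channel_density_le1 e mu c y : 0 < mu -> nrm2 c = e ->
  (\int[cn_std]_w (channel_density e mu (c * w) y)%:E <= 1)%E.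
Proof.
move=> mu0 ce; have M0 : 0 < Num.max e mu by rewrite lt_max mu0 orbT.
rewrite (eq_integral (fun w => ((Num.max e mu / mu)%:E *
  (expR ((Num.max e mu)^-1 * nrm2 (c * w) - mu^-1 * nrm2 (c * w - y)))%:E)%E)); last first.
  move=> w _; rewrite -EFinM; congr EFin.
  by rewrite /channel_density; congr (_ * expR _); ring.
have e0 : 0 <= e by rewrite -ce nrm2_ge0.
rewrite ge0_integralZl_EFin ?divr_ge0 ?(ltW M0) ?(ltW mu0)//; last first.
  apply/measurable_EFinP/measurableT_comp => //.
  apply: measurable_funB; apply: measurable_funM => //;
    apply: measurableT_comp (measurable_nrm2) _; first exact: measurable_complexZ.
  by apply: measurable_complexB => //; exact: measurable_complexZ.
have aE : 1 + (mu^-1 - (Num.max e mu)^-1) * e = Num.max e mu / mu.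
  case: (leP e mu) => emu; field; rewrite ?gt_eqF//=.
  by rewrite (lt_trans mu0 emu).
have a0 : 0 < 1 + (mu^-1 - (Num.max e mu)^-1) * e by rewrite aE divr_gt0.
rewrite cn_std_exp_nrm2 ce; last by move: a0; lra.
rewrite aE -EFinM lee_fin mulrA divff ?mul1r; last by rewrite gt_eqF// divr_gt0.
rewrite -expR0 ler_expR.
have -> : mu^-1 ^+ 2 * e * nrm2 y / (Num.max e mu / mu) - mu^-1 * nrm2 y =
    - (mu^-1 * nrm2 y * ((Num.max e mu - e) / Num.max e mu)).
  by field; rewrite !gt_eqF.
rewrite oppr_le0; apply: mulr_ge0; first by rewrite mulr_ge0 ?nrm2_ge0 ?invr_ge0 ?ltW.
by rewrite divr_ge0 ?(ltW M0)// subr_ge0 le_max lexx.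
Qed.

Lemma cn_std_mgf tau c : tau * nrm2 c < 1 ->
  (\int[cn_std]_w (expR (tau * nrm2 (c * w)))%:E = (1 - tau * nrm2 c)^-1%:E)%E.
Proof.
move=> h; rewrite (eq_integral (fun w => (expR (tau * nrm2 (c * w) -
  0 * nrm2 (c * w - 0)))%:E)); last by move=> w _; rewrite mul0r subr0.
rewrite cn_std_exp_nrm2; last by lra.
by rewrite expr0n/= !mul0r subrr expR0 mulr1; congr (_^-1)%:E; ring.
Qed.

End scalar_channel.

(** * Recovering a mean from a moment generating function *)

Section exponential_moments.
Local Open Scope classical_set_scope.
Context d (T : measurableType d) (R : realType).

(** The limit tau -> 0 made explicit: if x < m, take tau = (m - x) / (2 x m), which makes the
    right-hand side half of the left and keeps tau x below 1. If x = 0, tau = 1 suffices. *)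
Lemma le_of_small_excess (m x : R) : 0 <= x -> 0 <= m ->
  (forall tau, 0 < tau -> tau * x < 1 -> m - x <= tau * (x * m)) -> m <= x.
Proof.
move=> x0 m0 H; rewrite leNgt; apply/negP => xm.
have [x_eq0|xn0] := eqVneq x 0.
  by have := H 1 ltr01; rewrite x_eq0 mulr0 mul0r mulr0 ltr01 => /(_ isT); lra.
have xgt0 : 0 < x by rewrite lt_neqAle eq_sym xn0.
have mgt0 : 0 < m by lra.
have xm0 : 0 < x * m by rewrite mulr_gt0.
have := H ((m - x) / (2 * (x * m))).
have -> : (m - x) / (2 * (x * m)) * x = (m - x) / (2 * m).
  by field; rewrite !gt_eqF.
have -> : (m - x) / (2 * (x * m)) * (x * m) = (m - x) / 2.
  by field; rewrite !gt_eqF.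
rewrite divr_gt0 ?mulr_gt0 ?subr_gt0// ltr_pdivrMr ?mulr_gt0//.
by move=> /(_ isT) h; have := h; rewrite mul1r; lra.
Qed.

Lemma le_of_small_deficit (m x : R) : 0 <= x -> 0 <= m ->
  (forall tau, 0 < tau -> x - m <= tau * (x * m)) -> x <= m.
Proof.
move=> x0 m0 H; rewrite leNgt; apply/negP => xm.
have [m_eq0|mn0] := eqVneq m 0.
  by have := H 1 ltr01; rewrite m_eq0 !mulr0; lra.
have mgt0 : 0 < m by rewrite lt_neqAle eq_sym mn0.
have xgt0 : 0 < x by lra.
have := H ((x - m) / (2 * (x * m))).
have -> : (x - m) / (2 * (x * m)) * (x * m) = (x - m) / 2.
  by field; rewrite !gt_eqF.
by rewrite divr_gt0 ?mulr_gt0 ?subr_gt0// => /(_ isT); lra.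
Qed.

(* Both bounds on the mean come from [1 + tau u <= expR (tau u)], with [tau]
   of either sign tending to [0]. *)
Lemma integral_of_mgf (P : probability T R) (u : T -> R) (x : R) :
  measurable_fun setT u -> (forall w, 0 <= u w) -> 0 <= x ->
  (forall tau, tau * x < 1 ->
     (\int[P]_w (expR (tau * u w))%:E = (1 - tau * x)^-1%:E)%E) ->
  (\int[P]_w (u w)%:E = x%:E)%E.
Proof.
move=> mu u0 x0 mgf.
have P1 : (\int[P]_w (cst 1 w) = 1)%E.
  by rewrite integral_cst// mul1e; exact: probability_setT.
have mEu : measurable_fun setT (fun w => (u w)%:E) by exact/measurable_EFinP.
have mexp tau : measurable_fun setT (fun w => (expR (tau * u w))%:E).
  by apply/measurable_EFinP/measurableT_comp => //; exact: measurable_funM.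
have I0 : (0 <= \int[P]_w (u w)%:E)%E.
  by apply: integral_ge0 => w _; rewrite lee_fin.
have upper tau : 0 < tau -> tau * x < 1 ->
    (1 + tau%:E * \int[P]_w (u w)%:E <= (1 - tau * x)^-1%:E)%E.
  move=> t0 tx; rewrite -mgf// -{1}P1 -ge0_integralZl_EFin ?(ltW t0)//; last first.
    by move=> w _; rewrite lee_fin.
  rewrite -ge0_integralD//; last 2 first.
  - by move=> w _; rewrite -EFinM lee_fin mulr_ge0// ltW.
  - exact: measurable_funeM.
  apply: ge0_le_integral => //.
  - by move=> w _; rewrite -EFinM -EFinD lee_fin addr_ge0// mulr_ge0// ltW.
  - by apply: emeasurable_funD => //; exact: measurable_funeM.
  - by move=> w _; rewrite -EFinM -EFinD lee_fin expR_ge1Dx.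
(* An infinite mean would contradict [upper] at any admissible positive tau; 1 / (2 (x + 1)) is
   one. *)
have Ifin : (\int[P]_w (u w)%:E)%E \is a fin_num.
  rewrite ge0_fin_numE//; pose t := (2 * (x + 1))^-1.
  have t_gt0 : 0 < t by rewrite invr_gt0; lra.
  have tx : t * x < 1 by rewrite mulrC ltr_pdivrMr; lra.
  rewrite ltey; apply/eqP => Ioo; have := upper t t_gt0 tx.
  by rewrite Ioo gt0_muley ?lte_fin// addey// leye_eq.
have ui : P.-integrable setT (fun w => (u w)%:E).
  apply/integrableP; split => //.
  under eq_integral do rewrite gee0_abs ?lee_fin//.
  by rewrite -ge0_fin_numE.
move: Ifin I0 upper => /fineK; set m := fine _ => mE; rewrite -mE lee_fin => m0 upper.
congr EFin; apply/eqP; rewrite eq_le; apply/andP; split.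
  apply: le_of_small_excess => // tau t0 tx.
  have tx0 : 0 < 1 - tau * x by lra.
  have := upper _ t0 tx; rewrite -EFinM -EFinD lee_fin -[leRHS]mul1r.
  rewrite ler_pdivlMr// => h.
  suff : 0 <= tau * (x - m + tau * (x * m)) by rewrite pmulr_rge0//; lra.
  by move: h; lra.
apply: le_of_small_deficit => // tau t0.
have tx0 : 0 < 1 + tau * x by rewrite ltr_pwDl// mulr_ge0// ltW.
(* The hypothesis at - tau; the mean is now known to be finite, so the difference may be integrated
   term by term. *)
have : (1 - tau%:E * m%:E <= (1 + tau * x)^-1%:E)%E.
  have := mgf (- tau); rewrite mulNr opprK => <-; last first.
    by rewrite (le_lt_trans _ ltr01)// oppr_le0 mulr_ge0// ltW.
  rewrite -{1}P1 mE -integralZl// -integralB//; last 2 first.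
  - exact: finite_measure_integrable_cst.
  - exact: integrableZl.
  apply: le_integralT => //.
  - by apply: emeasurable_funB => //; exact: measurable_funeM.
  - by move=> w; rewrite -EFinM -EFinB lee_fin -mulNr expR_ge1Dx.
rewrite -EFinM -EFinB lee_fin -[leRHS]mul1r ler_pdivlMr// => h.
suff : 0 <= tau * (m - x + tau * (x * m)) by rewrite pmulr_rge0//; lra.
by move: h; lra.
Qed.

End exponential_moments.

(** * Unitary changes of coordinates on tuples *)

Section lin_tuple_theory.
Context {R : realType} {N : nat}.
Implicit Types (A B U : 'M[R[i]]_N) (h y w : N.-tuple R[i]).
Local Open Scope sesquilinear_scope.

Lemma tnth_lin_tuple A w i : tnth (lin_tuple A w) i = \sum_j A i j * tnth w j.
Proof. by rewrite tnth_mktuple. Qed.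

Lemma lin_tupleM A B w : lin_tuple A (lin_tuple B w) = lin_tuple (A *m B) w.
Proof.
apply: eq_from_tnth => i; rewrite !tnth_lin_tuple.
under eq_bigr => j _ do rewrite tnth_lin_tuple mulr_sumr.
rewrite exchange_big/=; apply: eq_bigr => k _; rewrite mxE mulr_suml.
by apply: eq_bigr => j _; rewrite mulrA.
Qed.

Lemma tnth_lin_tuple_diag (d : 'rV[R[i]]_N) w i :
  tnth (lin_tuple (diag_mx d) w) i = d 0 i * tnth w i.
Proof.
rewrite tnth_lin_tuple (bigD1 i)//= big1 ?addr0; first by rewrite mxE eqxx mulr1n.
by move=> j ji; rewrite mxE eq_sym (negbTE ji) mulr0n mul0r.
Qed.

(** [cov_factor] has the form of the inner matrix, so in the coordinates given by [U] the source is
    a vector of scaled iid entries. *)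
Lemma tnth_lin_tuple_unitary U (d : 'rV[R[i]]_N) w i : U \is unitarymx ->
  tnth (lin_tuple U (lin_tuple (invmx U *m diag_mx d) w)) i = d 0 i * tnth w i.
Proof.
move=> uU; rewrite lin_tupleM mulmxA mulmxV ?mul1mx ?tnth_lin_tuple_diag//.
exact: unitarymx_unit.
Qed.

Lemma nrm2E (z : R[i]) : (nrm2 z)%:C = z * z^*%C.
Proof.
by case: z => a b; apply/eqP; rewrite eq_complex /nrm2/=; apply/andP; split; apply/eqP; ring.
Qed.

(** Both sides are v^* v for the difference vector v, since U^* U = 1. Distortion may thus be
    measured in eigencoordinates. *)
Lemma sum_nrm2_lin_tuple U h y : U \is unitarymx ->
  \sum_j nrm2 (tnth (lin_tuple U h) j - tnth (lin_tuple U y) j) =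
  \sum_j nrm2 (tnth h j - tnth y j).
Proof.
move=> uU; pose v : 'cV[R[i]]_N := \col_j (tnth h j - tnth y j).
have sumE (x : 'cV[R[i]]_N) : (\sum_j nrm2 (x j 0))%:C = (x ^t* *m x) 0 0.
  rewrite raddf_sum mxE; apply: eq_bigr => j _.
  by rewrite [LHS]nrm2E !mxE mulrC.
apply: (@complexI R); transitivity (((U *m v) ^t* *m (U *m v)) 0 0).
  rewrite -sumE; congr (_%:C); apply: eq_bigr => j _; congr nrm2.
  rewrite !tnth_lin_tuple -sumrB mxE; apply: eq_bigr => k _.
  by rewrite mxE mulrBr.
rewrite trmx_mul map_mxM mulmxA -(mulmxA (v ^t*)).
have -> : U ^t* *m U = 1%:M by rewrite -invmx_unitary// mulVmx// unitarymx_unit.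
rewrite mulmx1 -sumE; congr (_%:C); apply: eq_bigr => j _.
by rewrite mxE.
Qed.

End lin_tuple_theory.

(** * The test channel in eigencoordinates *)

Section vector_channel.
Context {R : realType} {N : nat}.
Variables (U : 'M[R[i]]_N) (d : 'rV[R[i]]_N) (mu : R).
Hypotheses (uU : U \is unitarymx) (mu_gt0 : 0 < mu).
Local Open Scope classical_set_scope.

Local Notation V := (N.-tuple R[i]).
Let e j : R := nrm2 (d 0 j).
Let M j : R := Num.max (e j) mu.
(** Standard deviations of the reconstruction; zero for coordinates at or below the water level. *)
Let t : 'rV[R[i]]_N := \row_j (Num.sqrt (M j - mu))%:C.
(** For [U] the [spectralmx] of S and [d] the square roots of its [spectral_diag], this unfolds to
    [cn_law S]. *)
Let P : probability V R :=
  distribution (iid cn_std N) (lin_tuple (invmx U *m diag_mx d)).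
Let Q : probability V R :=
  distribution (iid cn_std N) (lin_tuple (invmx U *m diag_mx t)).

Let M_gt0 j : 0 < M j. Proof. by rewrite lt_max mu_gt0 orbT. Qed.
Let e_ge0 j : 0 <= e j. Proof. exact: nrm2_ge0. Qed.

Let tE j : nrm2 (t 0 j) = M j - mu.
Proof.
rewrite mxE /nrm2/= expr0n/= addr0 sqr_sqrtr// subr_ge0.
by rewrite le_max lexx orbT.
Qed.

Let uc j (h : V) : R[i] := tnth (lin_tuple U h) j.

Let measurable_uc j : measurable_fun setT (uc j).
Proof. exact: measurableT_comp (measurable_tnth j) (measurable_lin_tuple U). Qed.

Let ucd j w : uc j (lin_tuple (invmx U *m diag_mx d) w) = d 0 j * tnth w j.
Proof. exact: tnth_lin_tuple_unitary. Qed.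

Let uct j w : uc j (lin_tuple (invmx U *m diag_mx t) w) = t 0 j * tnth w j.
Proof. exact: tnth_lin_tuple_unitary. Qed.

Definition vector_density (z : V * V) : R :=
  \prod_j channel_density (e j) mu (uc j z.1) (uc j z.2).

Let G := vector_density.

Let measurable_uc1 j : measurable_fun setT (fun z : V * V => uc j z.1).
Proof. exact: measurableT_comp (measurable_uc j) measurable_fst. Qed.

Let measurable_uc2 j : measurable_fun setT (fun z : V * V => uc j z.2).
Proof. exact: measurableT_comp (measurable_uc j) measurable_snd. Qed.

Let dist j (z : V * V) : R := nrm2 (uc j z.1 - uc j z.2).

Let measurable_dist j : measurable_fun setT (dist j).
Proof.
by apply: measurableT_comp measurable_nrm2 _; exact: measurable_complexB.
Qed.

Lemma measurable_vector_density : measurable_fun setT G.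
Proof. by apply: measurable_prod => j _; exact: measurable_channel_density. Qed.

Lemma vector_density_gt0 z : 0 < G z.
Proof. by apply: prodr_gt0 => j _; exact: channel_density_gt0. Qed.

Let measurable_EG1 y : measurable_fun setT (fun h => (G (h, y))%:E).
Proof.
apply/measurable_EFinP.
exact: measurableT_comp measurable_vector_density (measurable_pair2 y).
Qed.

Let measurable_EG2 h : measurable_fun setT (fun y => (G (h, y))%:E).
Proof.
apply/measurable_EFinP.
exact: measurableT_comp measurable_vector_density (measurable_pair1 h).
Qed.

Lemma integral_vector_density_le1 y : (\int[P]_h (G (h, y))%:E <= 1)%E.
Proof.
rewrite ge0_integral_pushforward//=; last first.
  by move=> h _; rewrite lee_fin ltW// vector_density_gt0.
rewrite preimage_setT.
(* The product rule for iid coordinates takes real values, so each factor's integral is first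
   identified with a real number in [0, 1]. *)
have I j : exists2 c, (\int[cn_std]_w (channel_density (e j) mu (d 0 j * w) (uc j y))%:E
    = c%:E)%E & 0 <= c <= 1.
  have := @channel_density_le1 R _ mu _ (uc j y) mu_gt0 (erefl (e j)).
  have : (0 <= \int[cn_std]_w (channel_density (e j) mu (d 0 j * w) (uc j y))%:E)%E.
    by apply: integral_ge0 => w _; rewrite lee_fin ltW// channel_density_gt0.
  case: (\int[cn_std]_w _)%E => [c||]//; rewrite !lee_fin => c0 c1.
  by exists c; rewrite ?c0.
pose c j := s2val (cid2 (I j)).
rewrite (eq_integral (fun w : N.-tuple R[i] => (\prod_j
    channel_density (e j) mu (d 0 j * tnth w j) (uc j y))%:E)); last first.
  by move=> w _; rewrite /G /vector_density/=; under eq_bigr do rewrite ucd.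
rewrite (@ge0_integral_iid_prod _ _ _ _ _
  (fun j w => channel_density (e j) mu (d 0 j * w) (uc j y)) c).
- by rewrite lee_fin; apply: prodr_ile1 => j _; rewrite /c; case: cid2.
- by move=> j; apply: measurable_channel_density => //; exact: measurable_complexZ.
- by move=> j w; rewrite ltW// channel_density_gt0.
- by move=> j; rewrite /c; case: cid2.
Qed.

Lemma integral_vector_density_out h : (\int[Q]_y (G (h, y))%:E = 1)%E.
Proof.
rewrite ge0_integral_pushforward//=; last first.
  by move=> y _; rewrite lee_fin ltW// vector_density_gt0.
rewrite preimage_setT.
rewrite (eq_integral (fun w : N.-tuple R[i] => (\prod_j
    channel_density (e j) mu (uc j h) (t 0 j * tnth w j))%:E)); last first.
  by move=> w _; rewrite /G /vector_density/=; under eq_bigr do rewrite uct.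
rewrite (@ge0_integral_iid_prod _ _ _ _ _
  (fun j w => channel_density (e j) mu (uc j h) (t 0 j * w)) (fun=> 1)).
- by rewrite big1.
- by move=> j; apply: measurable_channel_density => //; exact: measurable_complexZ.
- by move=> j w; rewrite ltW// channel_density_gt0.
- by move=> j; apply: channel_density_kernel => //; rewrite tE.
Qed.

(* Weighting a single coordinate [j] by [expR (tau * dist j)] leaves the other
   factors equal to [1]. *)
Lemma integral_vector_density_mgf j tau z : tau * Num.min (e j) mu < 1 ->
  (\int[P]_h (expR (tau * dist j (h, lin_tuple (invmx U *m diag_mx t) z)) *
     G (h, lin_tuple (invmx U *m diag_mx t) z))%:E =
   (1 - tau * Num.min (e j) mu)^-1%:E)%E.
Proof.
move=> tj; set y := lin_tuple _ _.
have mexpG : measurable_fun setT (fun h => (expR (tau * dist j (h, y)) * G (h, y))%:E).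
  apply/measurable_EFinP/measurable_funM; last first.
    exact: measurableT_comp measurable_vector_density (measurable_pair2 y).
  apply: measurableT_comp => //; apply: measurable_funM => //.
  exact: measurableT_comp (measurable_dist j) (measurable_pair2 y).
rewrite ge0_integral_pushforward//=; last first.
  by move=> h _; rewrite lee_fin mulr_ge0 ?expR_ge0// ltW// vector_density_gt0.
rewrite preimage_setT.
pose T i := if i == j then tau else 0.
rewrite (eq_integral (fun w : N.-tuple R[i] => (\prod_i
    (channel_density (e i) mu (d 0 i * tnth w i) (t 0 i * tnth z i) *
     expR (T i * nrm2 (d 0 i * tnth w i - t 0 i * tnth z i))))%:E)); last first.
  move=> w _; rewrite big_split/= mulrC; congr (_ * _)%:E.
    by rewrite /G /vector_density/=; under eq_bigr do rewrite ucd uct.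
  rewrite (bigD1 j)//= big1 ?mulr1.
    by rewrite /T eqxx /dist/= ucd uct.
  by move=> i ij; rewrite /T (negbTE ij) mul0r expR0.
rewrite (@ge0_integral_iid_prod _ _ _ _ _
  (fun i w => channel_density (e i) mu (d 0 i * w) (t 0 i * tnth z i) *
     expR (T i * nrm2 (d 0 i * w - t 0 i * tnth z i)))
  (fun i => (1 - T i * Num.min (e i) mu)^-1)).
- rewrite (bigD1 j)//= big1 ?mulr1; first by rewrite /T eqxx.
  by move=> i ij; rewrite /T (negbTE ij) mul0r subr0 invr1.
- move=> i; apply: measurable_funM.
    by apply: measurable_channel_density => //; exact: measurable_complexZ.
  apply: measurableT_comp => //; apply: measurable_funM => //.
  apply: measurableT_comp measurable_nrm2 _.
  by apply: measurable_complexB => //; exact: measurable_complexZ.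
- by move=> i w; rewrite mulr_ge0 ?expR_ge0// ltW// channel_density_gt0.
- move=> i; apply: channel_density_mgf; rewrite ?tE//.
  by rewrite /T; case: eqP => [->//|_]; rewrite mul0r.
Qed.

Lemma integral_source_mgf j tau : tau * e j < 1 ->
  (\int[P]_h (expR (tau * nrm2 (uc j h)))%:E = (1 - tau * e j)^-1%:E)%E.
Proof.
move=> tj.
have mexp : measurable_fun setT (fun h => (expR (tau * nrm2 (uc j h)))%:E).
  apply/measurable_EFinP/measurableT_comp => //; apply: measurable_funM => //.
  exact: measurableT_comp measurable_nrm2 (measurable_uc j).
rewrite ge0_integral_pushforward//= preimage_setT.
pose T i := if i == j then tau else 0.
rewrite (eq_integral (fun w : N.-tuple R[i] => (\prod_i
     expR (T i * nrm2 (d 0 i * tnth w i)))%:E)); last first.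
  move=> w _; congr EFin; rewrite (bigD1 j)//= big1 ?mulr1.
    by rewrite /T eqxx ucd.
  by move=> i ij; rewrite /T (negbTE ij) mul0r expR0.
rewrite (@ge0_integral_iid_prod _ _ _ _ _
  (fun i w => expR (T i * nrm2 (d 0 i * w))) (fun i => (1 - T i * e i)^-1)).
- rewrite (bigD1 j)//= big1 ?mulr1; first by rewrite /T eqxx.
  by move=> i ij; rewrite /T (negbTE ij) mul0r subr0 invr1.
- move=> i; apply: measurableT_comp => //; apply: measurable_funM => //.
  apply: measurableT_comp measurable_nrm2 _; exact: measurable_complexZ.
- by move=> i w; rewrite expR_ge0.
- move=> i; apply: cn_std_mgf.
  by rewrite /T; case: eqP => [->//|_]; rewrite mul0r.
Qed.

Let measurable_power j : measurable_fun setT (fun h => nrm2 (uc j h)).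
Proof. exact: measurableT_comp measurable_nrm2 (measurable_uc j). Qed.

Lemma integral_source_power j : (\int[P]_h (nrm2 (uc j h))%:E = (e j)%:E)%E.
Proof.
apply: integral_of_mgf => //; first by move=> h; exact: nrm2_ge0.
exact: integral_source_mgf.
Qed.

Let log2_vector_density z : log2 (G z) = \sum_j log2 (M j / mu) +
  (\sum_j nrm2 (uc j z.1) / M j - (\sum_j dist j z) / mu) / ln 2.
Proof.
have lnprod (I : finType) (f : I -> R) : (forall i, 0 < f i) ->
    ln (\prod_i f i) = \sum_i ln (f i).
  move=> f0.
  suff : 0 < \prod_i f i /\ ln (\prod_i f i) = \sum_i ln (f i) by case.
  apply: (big_rec2 (fun x y => 0 < x /\ ln x = y)); first by rewrite ln1.
  move=> i x y _ [y0 <-]; rewrite mulr_gt0// lnM ?posrE//.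
rewrite /log2 /G /vector_density lnprod; last by move=> j; exact: channel_density_gt0.
rewrite -mulr_suml -mulrDl [X in _ - X]mulr_suml -sumrB -big_split/=; congr (_ / _).
apply: eq_bigr => j _; rewrite /channel_density [LHS]lnM ?posrE ?expR_gt0//; last exact: (divr_gt0 (M_gt0 j)).
by rewrite expRK.
Qed.

(** log2 of the density is affine in the sum of |h'_j|^2 / M_j, whose mean is fixed by the source
    marginal, and in the total squared error, whose mean is [b]. *)
Lemma integral_log2_vector_density (J : probability (V * V)%type R) (b : R) :
  (forall A, measurable A -> distribution J (@fst V V) A = P A) ->
  (\int[J]_z (\sum_j dist j z)%:E = b%:E)%E ->
  J.-integrable setT (fun z => (log2 (G z))%:E) /\
  (\int[J]_z (log2 (G z))%:E =
    (\sum_j log2 (M j / mu) + (\sum_j e j / M j - b / mu) / ln 2)%:E)%E.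
Proof.
move=> JP Jb.
have intE (f : V * V -> R) (c : R) : measurable_fun setT f -> (forall z, 0 <= f z) ->
    (\int[J]_z (f z)%:E = c%:E)%E -> J.-integrable setT (fun z => (f z)%:E).
  move=> mf f0 fc; apply/integrableP; split; first exact/measurable_EFinP.
  under eq_integral do rewrite gee0_abs ?lee_fin//.
  by rewrite fc ltry.
pose X (z : V * V) := \sum_j nrm2 (uc j z.1) / M j.
pose Y (z : V * V) := \sum_j dist j z.
have mX1 j : measurable_fun setT (fun z : V * V => nrm2 (uc j z.1)).
  exact: measurableT_comp measurable_nrm2 (measurable_uc1 j).
have mX : measurable_fun setT X.
  by apply: measurable_sum => j; exact: measurable_funM.
have mY : measurable_fun setT Y by apply: measurable_sum.
have X0 z : 0 <= X z.
  by apply: sumr_ge0 => j _; rewrite divr_ge0 ?nrm2_ge0// ltW.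
have Y0 z : 0 <= Y z by apply: sumr_ge0 => j _; exact: nrm2_ge0.
have EX : (\int[J]_z (X z)%:E = (\sum_j e j / M j)%:E)%E.
  under eq_integral do rewrite /X -sumEFin.
  rewrite ge0_integral_sum//; last 2 first.
  - by move=> j; apply/measurable_EFinP; exact: measurable_funM.
  - by move=> j z _; rewrite lee_fin divr_ge0 ?nrm2_ge0// ltW.
  rewrite -sumEFin; apply: eq_bigr => j _.
  under eq_integral do rewrite mulrC EFinM.
  rewrite ge0_integralZl_EFin ?invr_ge0 ?(ltW (M_gt0 j))//; last 2 first.
  - by move=> z _; rewrite lee_fin nrm2_ge0.
  - exact/measurable_EFinP.
  rewrite mulrC EFinM -integral_source_power; congr (_ * _)%E.
  rewrite -(@eq_measure_integral _ _ _ _ _ (distribution J (@fst V V))); last first.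
    by move=> A mA _; exact: JP.
  rewrite ge0_integral_pushforward//.
  - by apply/measurable_EFinP; exact: measurable_power.
  - by move=> h _; rewrite lee_fin nrm2_ge0.
have iX := intE _ _ mX X0 EX; have iY := intE _ _ mY Y0 Jb.
pose k := (ln 2 : R)^-1.
have eq1 : (fun z => (log2 (G z))%:E) = (cst (\sum_j log2 (M j / mu))%:E \+
    ((fun z => k%:E * (X z)%:E) \- (fun z => (k / mu)%:E * (Y z)%:E)))%E.
  apply/funext => z; rewrite log2_vector_density /cst/= -!EFinM -EFinB -EFinD.
  by rewrite /X /Y /k; congr (_ + _)%:E; ring.
have ic : J.-integrable setT (cst (\sum_j log2 (M j / mu))%:E).
  exact: finite_measure_integrable_cst.
have i1 : J.-integrable setT (fun z => k%:E * (X z)%:E)%E by exact: integrableZl.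
have i2 : J.-integrable setT (fun z => (k / mu)%:E * (Y z)%:E)%E by exact: integrableZl.
rewrite eq1; split; first by apply: integrableD => //; exact: integrableB.
rewrite integralD//; last exact: integrableB.
rewrite integralB// !integralZl// EX Jb integral_cst//.
rewrite [X in (_ * X + _)%E](_ : _ = 1%E); last exact: probability_setT.
rewrite mule1 -!EFinM -EFinB -EFinD; congr (_ + _)%:E.
by rewrite /k; ring.
Qed.

Let mean_distortionE (J : probability (V * V)%type R) :
  mean_distortion J = (\int[J]_z (N%:R^-1 * \sum_j dist j z)%:E)%E.
Proof.
apply: eq_integral => z _; congr (_ * _)%:E.
exact/esym/(sum_nrm2_lin_tuple z.1 z.2 uU).
Qed.

Lemma mutual_information_ge_waterfill (k : R.-pker V ~> V) (D : R) : (0 < N)%N ->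
  (mean_distortion (joint_law P k) <= D%:E)%E ->
  ((\sum_j log2 (M j / mu) + (\sum_j e j / M j - N%:R * D / mu) / ln 2)%:E
    <= mutual_information (joint_law P k))%E.
Proof.
move=> N_gt0; set J := joint_law P k; rewrite mean_distortionE => JD.
have mY : measurable_fun setT (fun z => \sum_j dist j z) by apply: measurable_sum.
have Y0 z : 0 <= \sum_j dist j z by apply: sumr_ge0 => j _; exact: nrm2_ge0.
have N0 : 0 < N%:R :> R by rewrite ltr0n.
have I0 : (0 <= \int[J]_z (\sum_j dist j z)%:E)%E.
  by apply: integral_ge0 => z _; rewrite lee_fin.
(* The distortion constraint forces a finite mean error [b]; the bound below decreases in [b], so
   [b] may be raised to N D. *)
have [b Jb bD] : exists2 b, (\int[J]_z (\sum_j dist j z)%:E = b%:E)%E & b <= N%:R * D.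
  move: JD; under eq_integral do rewrite EFinM.
  rewrite ge0_integralZl_EFin ?invr_ge0 ?ler0n//; last 2 first.
  - by move=> z _; rewrite lee_fin.
  - exact/measurable_EFinP.
  move: I0; case: (\int[J]_z _)%E => [b _|_|]//; last first.
    by rewrite gt0_muley ?lte_fin ?invr_gt0// leye_eq.
  rewrite -EFinM lee_fin => bD; exists b => //.
  by rewrite ler_pdivrMl// in bD.
have [iG EG] := integral_log2_vector_density
  (@distribution_fst_joint_law _ _ _ _ _ P k) Jb.
apply: le_trans (mutual_information_ge _ _ iG _); last 3 first.
- exact: measurable_vector_density.
- exact: vector_density_gt0.
- exact: integral_vector_density_le1.
rewrite EG lee_fin lerD2l ler_pM2r ?invr_gt0 ?ln_gt0 ?ltr1n//.
by rewrite lerD2l lerN2 ler_pM2r ?invr_gt0.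
Qed.

(** The kernel has density [G] with respect to [Q]; its mutual information is then the mean of log2
    [G] itself. *)
Lemma waterfill_test_channel : (0 < N)%N -> exists k : R.-pker V ~> V,
  mean_distortion (joint_law P k) = (N%:R^-1 * \sum_j Num.min (e j) mu)%:E /\
  mutual_information (joint_law P k) = (\sum_j log2 (M j / mu))%:E.
Proof.
move=> N_gt0; have G0 z : 0 <= G z by exact/ltW/vector_density_gt0.
pose k := density_kernel measurable_vector_density G0 integral_vector_density_out.
exists k; set J := joint_law P k.
have mEG : measurable_fun setT (fun z => (G z)%:E).
  by apply/measurable_EFinP; exact: measurable_vector_density.
have Jmgf j tau : tau * Num.min (e j) mu < 1 ->
    (\int[J]_z (expR (tau * dist j z))%:E = (1 - tau * Num.min (e j) mu)^-1%:E)%E.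
  move=> tj.
  have mex : measurable_fun setT (fun z => (expR (tau * dist j z))%:E).
    by apply/measurable_EFinP/measurableT_comp => //; exact: measurable_funM.
  rewrite ge0_integral_joint_law_density//.
  rewrite fubini_tonelli2; last 2 first.
  - exact: emeasurable_funM.
  - by move=> z; rewrite -EFinM lee_fin mulr_ge0// expR_ge0.
  rewrite ge0_integral_pushforward//; last 2 first.
  - apply: measurable_fun_fubini_tonelli_G; first exact: emeasurable_funM.
    by move=> z; rewrite -EFinM lee_fin mulr_ge0// expR_ge0.
  - move=> y _; apply: integral_ge0 => h _.
    by rewrite -EFinM lee_fin mulr_ge0// expR_ge0.
  rewrite preimage_setT (eq_integral (cst (1 - tau * Num.min (e j) mu)^-1%:E)).
    rewrite integral_cst// -[RHS]mule1; congr (_ * _)%E; exact: probability_setT.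
  (* With the input integrated first, the inner integral is the same for every output. *)
  by move=> z _; rewrite -(integral_vector_density_mgf z tj).
have Jdist j : (\int[J]_z (dist j z)%:E = (Num.min (e j) mu)%:E)%E.
  apply: integral_of_mgf => //; first by move=> z; exact: nrm2_ge0.
  - by rewrite le_min e_ge0 ltW.
  - exact: Jmgf.
have Jb : (\int[J]_z (\sum_j dist j z)%:E = (\sum_j Num.min (e j) mu)%:E)%E.
  under eq_integral do rewrite -sumEFin.
  rewrite ge0_integral_sum//; last 2 first.
  - by move=> j; exact/measurable_EFinP.
  - by move=> j z _; rewrite lee_fin nrm2_ge0.
  by rewrite -sumEFin; apply: eq_bigr => j _.
split.
  rewrite mean_distortionE; under eq_integral do rewrite EFinM.
  rewrite ge0_integralZl_EFin ?invr_ge0 ?ler0n//; last 2 first.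
  - by move=> z _; rewrite lee_fin sumr_ge0// => j _; exact: nrm2_ge0.
  - by apply/measurable_EFinP; exact: measurable_sum.
  by rewrite Jb EFinM.
rewrite mutual_information_density.
  have [_ ->] := integral_log2_vector_density
    (@distribution_fst_joint_law _ _ _ _ _ P k) Jb.
  (* The distortion correction vanishes because e / max(e, mu) = min(e, mu) / mu. *)
  rewrite [X in (_ + X / _)%:E](_ : _ = 0) ?mul0r ?addr0//.
  apply/eqP; rewrite subr_eq0 mulr_suml; apply/eqP/eq_bigr => j _.
  rewrite /M; case: (leP (e j) mu) => ej; first by [].
  by rewrite !divff// gt_eqF// (lt_trans mu_gt0 ej).
(* The output law is [Q]: the weighted identity at tau = 0, for any coordinate, says that the
   density has mean 1 over the source. *)
move=> A mA; pose j0 := Ordinal N_gt0.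
have E1 z : (\int[P]_x (G (x, lin_tuple (invmx U *m diag_mx t) z))%:E = 1)%E.
  have := @integral_vector_density_mgf j0 0 z.
  rewrite mul0r subr0 invr1 => <-//.
  by apply: eq_integral => x _; rewrite mul0r expR0 mul1r.
rewrite ge0_integral_pushforward//; last 2 first.
- apply: measurable_funTS.
  exact: (@measurable_fun_fubini_tonelli_G _ _ _ _ _ P _ mEG (fun z => G0 z)).
- by move=> y _; apply: integral_ge0 => h _; rewrite lee_fin.
rewrite (eq_integral (cst 1%E)); last by move=> z _; exact: E1.
rewrite integral_cst ?mul1e// -[X in measurable X]setTI.
exact: measurable_lin_tuple.
Qed.

End vector_channel.

(** * Spectral diagonal and eigenvalues of a covariance matrix *)

Section covariance_eigenvalues.
Local Open Scope sesquilinear_scope.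

Lemma char_poly_conj (C : fieldType) n (V A : 'M[C]_n) : V \in unitmx ->
  char_poly (invmx V *m A *m V) = char_poly A.
Proof.
move=> uV; have polyV : map_mx polyC (invmx V) *m map_mx polyC V = 1%:M.
  by rewrite -map_mxM mulVmx// map_mx1.
rewrite /char_poly; have -> : char_poly_mx (invmx V *m A *m V) =
    map_mx polyC (invmx V) *m char_poly_mx A *m map_mx polyC V.
  rewrite /char_poly_mx mulmxBr mulmxBl !map_mxM; congr (_ - _).
  by rewrite scalar_mxC -mulmxA polyV mulmx1.
by rewrite !det_mulmx mulrAC -det_mulmx polyV det1 mul1r.
Qed.

(** The quadratic form of S at its j-th unit eigenvector is the j-th eigenvalue. *)
Lemma spectral_diag_ge0 (C : numClosedFieldType) n (S : 'M[C]_n) j :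
  covariance_mx S -> 0 <= spectral_diag S 0 j.
Proof.
move=> [Sh Spos]; have /orthomx_spectralP /= := hermitian_normalmx Sh.
have := spectral_unitarymx S; move: (spectralmx S) (spectral_diag S) => U d uU.
rewrite invmx_unitary// => SE; have UU : U *m U ^t* = 1%:M by exact/unitarymxP.
have := Spos (U ^t* *m delta_mx j 0).
have adjK m p (B : 'M[C]_(m, p)) : (B ^t*) ^t* = B.
  by apply/matrixP => i k; rewrite !mxE conjCK.
rewrite trmx_mul map_mxM adjK trmx_delta map_delta_mx SE !mulmxA.
rewrite -(mulmxA (delta_mx 0 j)) UU mulmx1.
rewrite -(mulmxA (delta_mx 0 j *m diag_mx d)) UU mulmx1.
by rewrite -rowE -colE !mxE eqxx mulr1n.
Qed.

Lemma nrm2_sqrtC (R : realType) (z : R[i]) : 0 <= z -> (nrm2 (sqrtC z))%:C = z.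
Proof.
move=> z0; rewrite nrm2E -[RHS]sqrtCK expr2; congr (_ * _).
by apply: (@geC0_conj R[i]); rewrite sqrtC_ge0.
Qed.

(** The spectral diagonal and [lam] may list the eigenvalues in different orders. Both split the
    characteristic polynomial, hence are permutations of each other, and a sum does not see the
    order. *)
Lemma sum_eigenvalues (R : realType) n (S : 'M[R[i]]_n) (lam : 'I_n -> R)
    (F : R -> R) : covariance_mx S ->
  char_poly S = \prod_(m < n) ('X - ((lam m)%:C)%:P) ->
  \sum_j F (nrm2 (map_mx sqrtC (spectral_diag S) 0 j)) = \sum_m F (lam m).
Proof.
move=> Scov Slam; pose e j : R := nrm2 (map_mx sqrtC (spectral_diag S) 0 j).
have eE j : (e j)%:C = spectral_diag S 0 j.
  by rewrite /e mxE nrm2_sqrtC//; exact: spectral_diag_ge0.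
have Se : char_poly S = \prod_j ('X - ((e j)%:C)%:P).
  have [Sh _] := Scov; have /orthomx_spectralP /= SE := hermitian_normalmx Sh.
  rewrite [in LHS]SE char_poly_conj ?unitarymx_unit ?spectral_unitarymx//.
  rewrite char_poly_trig ?diag_mx_is_trig//.
  by apply: eq_bigr => j _; rewrite eE mxE eqxx mulr1n.
have : perm_eq [seq (e j)%:C | j <- index_enum 'I_n] [seq (lam j)%:C | j <- index_enum 'I_n].
  by apply: prod_XsubC_eq; rewrite !big_map -Slam Se.
move=> /(perm_map (@complex.Re R)); rewrite -!map_comp => pe.
have := perm_big _ pe : \sum_(x <- _) F x = \sum_(x <- _) F x.
by rewrite !big_map.
Qed.

End covariance_eigenvalues.

(** * The reverse-waterfilling form of the rate-distortion function *)

Section rate_bounds.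
Context {R : realType} {N : nat}.
Hypothesis N_gt0 : (0 < N)%N.
Implicit Types (lam : 'I_N -> R) (mu x : R).

(** For mu > 0 the positive part of log2(lam / mu) is log2(max(lam, mu) / mu), which keeps the rate
    in [R]. *)
Definition waterfill_bits lam mu : R :=
  N%:R^-1 * \sum_m log2 (Num.max (lam m) mu / mu).

Let N0 : 0 < N%:R :> R. Proof. by rewrite ltr0n. Qed.
Let l2 : 0 < ln 2 :> R. Proof. by rewrite ln_gt0// ltr1n. Qed.

Lemma waterfill_rateE lam mu : 0 < mu ->
  waterfill_rate lam mu = (waterfill_bits lam mu)%:E.
Proof.
move=> mu0; rewrite /waterfill_rate /waterfill_bits EFinM -sumEFin.
congr (_ * _)%E; apply: eq_bigr => m _; rewrite /log2_ratio_pos.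
case: (leP (lam m) mu) => h; first by rewrite divff ?gt_eqF// /log2 ln1 mul0r.
rewrite gt_eqF//; congr EFin; apply/max_idPl.
by rewrite /log2 divr_ge0 ?(ltW l2)// ln_ge0// ler_pdivlMr// mul1r ltW.
Qed.

(** All terms of the sum are nonnegative, so one positive eigenvalue already makes the rate
    unbounded as mu tends to 0. *)
Lemma waterfill_bits_ge lam mu m : 0 < mu -> 0 < lam m ->
  N%:R^-1 * log2 (lam m / mu) <= waterfill_bits lam mu.
Proof.
move=> mu0 lm; rewrite ler_pM2l ?invr_gt0// (bigD1 m)//=.
have pos i : 0 <= log2 (Num.max (lam i) mu / mu).
  by rewrite /log2 divr_ge0 ?(ltW l2)// ln_ge0// ler_pdivlMr// mul1r le_max lexx orbT.
apply: (@le_trans _ _ (log2 (Num.max (lam m) mu / mu))).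
  rewrite /log2 ler_pM2r ?invr_gt0// ler_ln ?posrE ?divr_gt0 ?lt_max ?lm//.
  by rewrite ler_pM2r ?invr_gt0// le_max lexx.
by rewrite lerDl sumr_ge0.
Qed.

Section covariance.
Variables (S : 'M[R[i]]_N) (lam : 'I_N -> R).
Hypotheses (Scov : covariance_mx S)
  (Slam : char_poly S = \prod_(m < N) ('X - ((lam m)%:C)%:P)).

(* The right-hand side is the tangent, of slope [- 1 / (mu * ln 2)], at the
   point of the rate-distortion curve with water level [mu]. *)
Lemma rate_distortion_ge mu x : 0 < mu ->
  ((waterfill_bits lam mu + (waterfill_distortion lam mu - x) / (mu * ln 2))%:E
    <= rate_distortion (cn_law S) x)%E.
Proof.
move=> mu0; set b := _ + _.
have -> : b%:E = ((N%:R^-1)%:E * (N%:R * b)%:E)%E by rewrite -EFinM mulKf// gt_eqF.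
rewrite /rate_distortion lee_pmul2l ?lte_fin ?invr_gt0//.
apply: le_ereal_inf_tmp => _ [k kD <-].
have := mutual_information_ge_waterfill (spectral_unitarymx S) mu0 N_gt0 kD.
rewrite (sum_eigenvalues (fun e => log2 (Num.max e mu / mu)) Scov Slam).
rewrite (sum_eigenvalues (fun e => e / Num.max e mu) Scov Slam).
apply: le_trans; rewrite lee_fin /b /waterfill_bits /waterfill_distortion.
rewrite mulrDr mulVKf ?gt_eqF// lerD2l.
have -> : \sum_m lam m / Num.max (lam m) mu = (\sum_m Num.min (lam m) mu) / mu.
  rewrite mulr_suml; apply: eq_bigr => m _; case: (leP (lam m) mu) => // h.
  by rewrite !divff ?gt_eqF// (lt_trans mu0 h).
rewrite le_eqVlt; apply/orP; left; apply/eqP.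
by field; rewrite !gt_eqF.
Qed.

Lemma rate_distortion_le mu : 0 < mu ->
  (rate_distortion (cn_law S) (waterfill_distortion lam mu) <=
   (waterfill_bits lam mu)%:E)%E.
Proof.
move=> mu0; rewrite /rate_distortion /waterfill_bits [leRHS]EFinM.
rewrite lee_pmul2l ?lte_fin ?invr_gt0//.
have [k [kD kI]] := waterfill_test_channel (map_mx sqrtC (spectral_diag S))
  (spectral_unitarymx S) mu0 N_gt0.
rewrite -(sum_eigenvalues (fun e => log2 (Num.max e mu / mu)) Scov Slam) -kI.
apply: ereal_inf_lbound; exists k => //=; rewrite [leLHS]kD lee_fin.
by rewrite (sum_eigenvalues (fun e => Num.min e mu) Scov Slam).
Qed.

Lemma rate_distortion_waterfill mu : 0 < mu ->
  rate_distortion (cn_law S) (waterfill_distortion lam mu) =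
  (waterfill_bits lam mu)%:E.
Proof.
move=> mu0; apply/eqP; rewrite eq_le rate_distortion_le//=.
by have := rate_distortion_ge (waterfill_distortion lam mu) mu0; rewrite subrr mul0r addr0.
Qed.

Hypothesis lam_ge0 : forall m, 0 <= lam m.

Lemma waterfill_distortion0 : waterfill_distortion lam 0 = 0.
Proof.
by rewrite /waterfill_distortion big1 ?mulr0// => m _; apply/min_idPr.
Qed.

(** If all eigenvalues vanish, water level 1 also has distortion 0, and rate 0. Otherwise both sides
    are infinite: the tangents at small mu take arbitrarily large values at distortion 0. *)
Lemma rate_distortion0 : rate_distortion (cn_law S) 0 = waterfill_rate lam 0.
Proof.
have [[m lm]|lam0] := pselect (exists m, 0 < lam m); last first.
  have {}lam0 m : lam m = 0.
    apply/eqP; rewrite eq_le lam_ge0 andbT leNgt; apply/negP => lm.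
    by apply: lam0; exists m.
  have d1 : waterfill_distortion lam 1 = 0.
    by rewrite /waterfill_distortion big1 ?mulr0// => m _; rewrite lam0 min_l.
  rewrite -{1}d1 rate_distortion_waterfill// /waterfill_bits /waterfill_rate.
  rewrite !big1 ?mulr0 ?mule0// => m _; first by rewrite /log2_ratio_pos lam0 lexx.
  by rewrite lam0 max_r// divr1 /log2 ln1 mul0r.
have -> : waterfill_rate lam 0 = +oo%E.
  rewrite /waterfill_rate (bigD1 m)//= {1}/log2_ratio_pos leNgt lm/= eqxx.
  rewrite addye ?gt0_muley ?lte_fin ?invr_gt0//.
  rewrite -ltNye (@lt_le_trans _ _ 0%E)// sume_ge0// => i _.
  by rewrite /log2_ratio_pos; case: ifP => // _; rewrite eqxx.
apply/eqyP => r r0.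
(* Chosen so that the single term log2(lam_m / mu) / N equals [r]. *)
pose mu := lam m * expR (- (N%:R * r * ln 2)).
have mu0 : 0 < mu by rewrite mulr_gt0 ?expR_gt0.
apply: le_trans (rate_distortion_ge 0 mu0); rewrite lee_fin.
apply: (@le_trans _ _ (waterfill_bits lam mu)); last first.
  rewrite lerDl subr0; apply: divr_ge0; last by rewrite mulr_ge0// ltW.
  rewrite mulr_ge0 ?invr_ge0 ?ler0n// sumr_ge0// => i _.
  by rewrite le_min lam_ge0 ltW.
apply: le_trans (waterfill_bits_ge mu0 lm).
have -> : lam m / mu = expR (N%:R * r * ln 2).
  by rewrite /mu invfM mulrA divff ?mul1r ?gt_eqF// expRN invrK.
by rewrite /log2 expRK mulfK ?gt_eqF// mulKf// gt_eqF.
Qed.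

End covariance.

End rate_bounds.

(** * Optimal allocation among curves with known supporting lines *)

Section convex_allocation.
Context {R : realType} {K : nat}.
Variables (prior : 'I_K -> R) (rate : 'I_K -> R -> \bar R).
Variables (bits dist : 'I_K -> R -> R).
Hypothesis prior_gt0 : forall c, 0 < prior c.
(** Each curve is given by its supporting lines, parametrized by the water level. The slope depends
    on [mu] but not on [c], which is why a common level is optimal. *)
Hypothesis rate_ge : forall c mu x, 0 < mu ->
  ((bits c mu + (dist c mu - x) / (mu * ln 2))%:E <= rate c x)%E.
Hypothesis rate_dist : forall c mu, 0 < mu -> rate c (dist c mu) = (bits c mu)%:E.
Hypothesis dist_ge0 : forall c mu, 0 <= mu -> 0 <= dist c mu.
Hypothesis dist_lip : forall c mu nu, mu <= nu ->
  dist c nu <= dist c mu + (nu - mu).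

Let l2 : 0 < ln 2 :> R. Proof. by rewrite ln_gt0// ltr1n. Qed.

(* Away from its point of contact a tangent is beaten by the tangent at a
   slightly different water level, moved towards [x]. *)
Lemma rate_gt_tangent c mu x : 0 < mu -> x != dist c mu ->
  ((bits c mu + (dist c mu - x) / (mu * ln 2))%:E < rate c x)%E.
Proof.
move=> mu0 xd.
(* At [x] the tangent of level [nu] exceeds that of level [mu] by at least this product over ln 2,
   because the contact point of [nu] lies on or above the tangent of [mu]. *)
suff [nu nu0 gain] : exists2 nu, 0 < nu & 0 < (dist c nu - x) * (nu^-1 - mu^-1).
  apply: lt_le_trans (rate_ge c x nu0); rewrite lte_fin.
  have := rate_ge c (dist c nu) mu0; rewrite rate_dist// lee_fin => tangent.
  have {}gain : 0 < (dist c nu - x) * (nu^-1 - mu^-1) / ln 2 by rewrite divr_gt0.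
  have -> : bits c mu + (dist c mu - x) / (mu * ln 2) =
      bits c mu + (dist c mu - dist c nu) / (mu * ln 2)
      + (dist c nu - x) / (nu * ln 2)
      - (dist c nu - x) * (nu^-1 - mu^-1) / ln 2.
    by field; rewrite !gt_eqF.
  by lra.
have [dx|xd'|/esym/eqP] := ltgtP (dist c mu) x; last by rewrite (negbTE xd).
  (* Moving by half the gap keeps the contact point short of [x], by the Lipschitz bound. *)
  pose nu := mu + (x - dist c mu) / 2.
  have munu : mu < nu by rewrite /nu; lra.
  exists nu; first by lra.
  rewrite -mulrNN mulr_gt0//.
    by have := dist_lip c (ltW munu); rewrite /nu; lra.
  by rewrite opprB subr_gt0 ltf_pV2 ?posrE//; lra.
(* Half the gap again, capped by mu / 2 so that the new level stays positive. *)
pose del := Num.min (mu / 2) ((dist c mu - x) / 2).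
have d0 : 0 < del by rewrite lt_min; apply/andP; split; lra.
have d1 : del <= mu / 2 by rewrite ge_min lexx.
have d2 : del <= (dist c mu - x) / 2 by rewrite ge_min lexx orbT.
exists (mu - del); first by lra.
rewrite mulr_gt0//.
  by have := @dist_lip c (mu - del) mu; lra.
by rewrite subr_gt0 ltf_pV2 ?posrE; lra.
Qed.

Lemma average_rate_dist mu : 0 < mu ->
  average_rate prior rate (dist^~ mu) = (\sum_c prior c * bits c mu)%:E.
Proof.
move=> mu0; rewrite /average_rate -sumEFin; apply: eq_bigr => c _.
by rewrite rate_dist.
Qed.

(** The common slope factors out of the average, leaving the unspent distortion D - sum of prior
    times [Dc], which is nonnegative. *)
Lemma average_tangent_ge mu D (Dc : 'I_K -> R) : 0 < mu ->
  D = \sum_c prior c * dist c mu -> feasible prior D Dc ->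
  \sum_c prior c * bits c mu <=
  \sum_c prior c * (bits c mu + (dist c mu - Dc c) / (mu * ln 2)).
Proof.
move=> mu0 -> [_ DcD].
under [leRHS]eq_bigr do rewrite mulrDr mulrA mulrBr.
rewrite big_split/= lerDl -mulr_suml sumrB divr_ge0 ?mulr_ge0 ?(ltW mu0) ?(ltW l2)//.
by rewrite subr_ge0.
Qed.

Lemma average_rate_ge mu D (Dc : 'I_K -> R) : 0 < mu ->
  D = \sum_c prior c * dist c mu -> feasible prior D Dc ->
  ((\sum_c prior c * bits c mu)%:E <= average_rate prior rate Dc)%E.
Proof.
move=> mu0 DE DcD.
apply: (@le_trans _ _ (\sum_c prior c *
    (bits c mu + (dist c mu - Dc c) / (mu * ln 2)))%:E).
  by rewrite lee_fin; exact: average_tangent_ge DE DcD.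
rewrite -sumEFin; apply: lee_sum => c _.
by rewrite EFinM lee_pmul2l ?lte_fin// rate_ge.
Qed.

Lemma average_rate_gt mu D (Dc : 'I_K -> R) c0 : 0 < mu ->
  D = \sum_c prior c * dist c mu -> feasible prior D Dc ->
  Dc c0 != dist c0 mu ->
  ((\sum_c prior c * bits c mu)%:E < average_rate prior rate Dc)%E.
Proof.
move=> mu0 DE DcD Dc0.
apply: (@le_lt_trans _ _ (\sum_c prior c *
    (bits c mu + (dist c mu - Dc c) / (mu * ln 2)))%:E).
  by rewrite lee_fin; exact: average_tangent_ge DE DcD.
rewrite -sumEFin /average_rate (bigD1 c0)//= [ltRHS](bigD1 c0)//=.
(* Strictness at [c0] survives the addition because the other tangents sum to a real number. *)
apply: lte_leD.
- by rewrite sumEFin.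
- by rewrite EFinM lte_pmul2l ?lte_fin// rate_gt_tangent.
- by apply: lee_sum => c _; rewrite EFinM lee_pmul2l ?lte_fin// rate_ge.
Qed.

Lemma feasible_dist mu D : 0 < mu -> D = \sum_c prior c * dist c mu ->
  feasible prior D (dist^~ mu).
Proof. by move=> mu0 ->; split=> // c; rewrite dist_ge0// ltW. Qed.

Lemma optimal_allocation_dist mu D (Dc : 'I_K -> R) : 0 < mu ->
  D = \sum_c prior c * dist c mu ->
  optimal_allocation prior rate D Dc <-> forall c, Dc c = dist c mu.
Proof.
move=> mu0 DE; split=> [[DcD opt] c|Dcd].
  apply/eqP; apply: contraT => Dcc.
  have := opt _ (feasible_dist mu0 DE); rewrite average_rate_dist// leNgt.
  by rewrite (average_rate_gt mu0 DE DcD Dcc).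
have -> : Dc = dist^~ mu by apply/funext.
split; first exact: feasible_dist.
by move=> Dc' DcD'; rewrite average_rate_dist//; exact: average_rate_ge DE DcD'.
Qed.

Lemma conditional_rate_dist mu D : 0 < mu -> D = \sum_c prior c * dist c mu ->
  conditional_rate prior rate D = (\sum_c prior c * bits c mu)%:E.
Proof.
move=> mu0 DE; apply/eqP; rewrite eq_le; apply/andP; split.
  rewrite -average_rate_dist//; apply: ereal_inf_lbound.
  by exists (dist^~ mu) => //; exact: feasible_dist.
by apply: le_ereal_inf_tmp => _ [Dc DcD <-]; exact: average_rate_ge DE DcD.
Qed.

End convex_allocation.

(** * Existence of the common water level *)

Section water_level.
Import numFieldNormedType.Exports.
Context {R : realType} {N : nat}.
Hypothesis N_gt0 : (0 < N)%N.
Implicit Type lam : 'I_N -> R.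

Let N0 : 0 < N%:R :> R. Proof. by rewrite ltr0n. Qed.

Lemma waterfill_distortion_mono lam mu nu : mu <= nu ->
  waterfill_distortion lam mu <= waterfill_distortion lam nu.
Proof.
move=> h; rewrite ler_pM2l ?invr_gt0// ler_sum// => m _.
by rewrite le_min !ge_min lexx h orbT.
Qed.

Lemma waterfill_distortion_lip lam mu nu : mu <= nu ->
  waterfill_distortion lam nu <= waterfill_distortion lam mu + (nu - mu).
Proof.
move=> h; have -> : nu - mu = N%:R^-1 * \sum_(m < N) (nu - mu).
  by rewrite sumr_const card_ord -[X in _ * X]mulr_natl mulKf// gt_eqF.
rewrite -mulrDr ler_pM2l ?invr_gt0// -big_split/= ler_sum// => m _.
by case: (leP (lam m) mu); case: (leP (lam m) nu) => h1 h2; lra.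
Qed.

Lemma waterfill_distortion_ge0 lam mu : (forall m, 0 <= lam m) -> 0 <= mu ->
  0 <= waterfill_distortion lam mu.
Proof.
move=> lam0 mu0; rewrite mulr_ge0 ?invr_ge0 ?ler0n// sumr_ge0// => m _.
by rewrite le_min lam0.
Qed.

Lemma log2_ratio_pos_ge0 (l mu : R) : (0 <= log2_ratio_pos l mu)%E.
Proof.
rewrite /log2_ratio_pos; case: ifP => // _; case: ifP => // _.
by rewrite lee_fin le_max lexx orbT.
Qed.

Variables (K : nat) (prior : 'I_K -> R) (lam : 'I_K -> 'I_N -> R).
Hypotheses (prior_gt0 : forall c, 0 < prior c) (prior_sum1 : \sum_c prior c = 1).
Hypothesis lam_ge0 : forall c m, 0 <= lam c m.

Let total mu := \sum_c prior c * waterfill_distortion (lam c) mu.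

Lemma sum_waterfill_distortion mu :
  N%:R^-1 * \sum_c prior c * \sum_m Num.min (lam c m) mu = total mu.
Proof. by rewrite mulr_sumr; apply: eq_bigr => c _; rewrite mulrCA. Qed.

(** At mu = 0 terms may be infinite; nonnegativity allows the factor 1 / N to be distributed. *)
Lemma sum_waterfill_rate mu :
  (\sum_c (prior c)%:E * waterfill_rate (lam c) mu =
   (N%:R^-1)%:E * \sum_c (prior c)%:E * \sum_m log2_ratio_pos (lam c m) mu)%E.
Proof.
rewrite ge0_sume_distrr; last first.
  move=> c _; rewrite mule_ge0 ?lee_fin ?(ltW (prior_gt0 c))// sume_ge0// => m _.
  exact: log2_ratio_pos_ge0.
by apply: eq_bigr => c _; rewrite muleCA.
Qed.

(** Intermediate value theorem for the total distortion, which is 1-Lipschitz in the level because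
    the priors sum to 1. *)
Lemma water_level_exists D : 0 < D ->
  D <= N%:R^-1 * \sum_c prior c * \sum_m lam c m ->
  exists2 mu, 0 < mu & D = total mu.
Proof.
move=> D0 Dmax.
have total_dist x y : `|total x - total y| <= `|x - y|.
  wlog xy : x y / y <= x.
    move=> H; have [/H//|/ltW/H] := leP y x.
    by rewrite distrC (distrC y).
  rewrite (ger0_norm (_ : 0 <= x - y)) ?subr_ge0// -sumrB.
  under eq_bigr do rewrite -mulrBr.
  rewrite ger0_norm.
    rewrite -[leRHS]mul1r -prior_sum1 mulr_suml ler_sum// => c _.
    rewrite ler_pM2l//; have := waterfill_distortion_lip (lam c) xy; lra.
  apply: sumr_ge0 => c _; rewrite mulr_ge0 ?(ltW (prior_gt0 c))// subr_ge0.
  exact: waterfill_distortion_mono.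
(* A level above every eigenvalue, where the total distortion has reached its maximum. *)
pose B := \sum_c \sum_m lam c m.
have lamB c m : lam c m <= B.
  rewrite /B (bigD1 c)//= (bigD1 m)//= -addrA lerDl addr_ge0// sumr_ge0// => ? _.
  exact: sumr_ge0.
have B0 : 0 <= B by apply: sumr_ge0 => c _; exact: sumr_ge0.
have T0 : total 0 = 0.
  by rewrite /total big1// => c _; rewrite waterfill_distortion0 ?mulr0.
have TB : D <= total B.
  apply: le_trans Dmax _; rewrite -sum_waterfill_distortion le_eqVlt; apply/orP; left.
  apply/eqP; congr (_ * _); apply: eq_bigr => c _; congr (_ * _).
  by apply: eq_bigr => m _; rewrite min_l.
have [||mu muB TE] := @IVT R total 0 B D B0.
- apply: continuous_subspaceT => x; apply/cvgrPdist_lt => eps eps0.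
  apply/nbhs_normP; exists eps => //= y; exact/le_lt_trans/total_dist.
- by rewrite T0 ge_min le_max ltW// TB orbT.
exists mu => //; move: muB; rewrite in_itv/= => /andP[].
by rewrite le_eqVlt => /predU1P[mu0|//]; move: D0; rewrite -TE -mu0 T0 ltxx.
Qed.

End water_level.

(** * Global water level for the conditional rate *)

Theorem theorem1 (R : realType) (K N : nat) (K_gt0 : (0 < K)%N) (N_gt0 : (0 < N)%N)
    (prior : 'I_K -> R) (prior_gt0 : forall c, 0 < prior c)
    (prior_sum1 : \sum_(c < K) prior c = 1)
    (Rc : 'I_K -> 'M[R[i]]_N) (Rc_cov : forall c, covariance_mx (Rc c))
    (lam : 'I_K -> 'I_N -> R)
    (lam_eigen : forall c,
       char_poly (Rc c) = \prod_(m < N) ('X - ((lam c m)%:C)%:P))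
    (lam_sorted : forall c (m n : 'I_N), (m <= n)%N -> lam c n <= lam c m)
    (lam_ge0 : forall c m, 0 <= lam c m)
    (D : R) (D_ge0 : 0 <= D)
    (D_max : D <= N%:R^-1 * \sum_(c < K) prior c * \sum_(m < N) lam c m) :
  let rate := fun c => rate_distortion (cn_law (Rc c)) in
  exists mu : R,
    [/\ 0 <= mu,
        forall Dc : 'I_K -> R,
          optimal_allocation prior rate D Dc <->
          forall c, Dc c = waterfill_distortion (lam c) mu,
        forall c,
          rate c (waterfill_distortion (lam c) mu) = waterfill_rate (lam c) mu,
        conditional_rate prior rate D =
          ((N%:R^-1)%:E * \sum_(c < K) (prior c)%:E *
             \sum_(m < N) log2_ratio_pos (lam c m) mu)%E
      & D = N%:R^-1 * \sum_(c < K) prior c * \sum_(m < N) Num.min (lam c m) mu].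
Proof.
move=> rate.
have rate_ge c := @rate_distortion_ge R N N_gt0 _ _ (Rc_cov c) (lam_eigen c).
have rate_wf c := @rate_distortion_waterfill R N N_gt0 _ _ (Rc_cov c) (lam_eigen c).
(* For D = 0 the level is 0, where the tangents degenerate; there the zero allocation is the single
   feasible one, since all priors are positive, and the rate may be infinite. *)
have [D0|D_neq0] := eqVneq D 0.
  have rate0 c : rate c 0 = waterfill_rate (lam c) 0.
    exact: (rate_distortion0 N_gt0 (Rc_cov c) (lam_eigen c) (lam_ge0 c)).
  have wd0 c : waterfill_distortion (lam c) 0 = 0.
    exact: waterfill_distortion0 (lam_ge0 c).
  have feas (Dc : 'I_K -> R) : feasible prior D Dc <-> forall c, Dc c = 0.
    rewrite D0; split=> [[Dc0 DcD] c|Dc0]; last first.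
      by split=> [c|]; rewrite ?Dc0// big1// => c _; rewrite Dc0 mulr0.
    have /psumr_eq0P : \sum_c prior c * Dc c = 0.
      by apply/eqP; rewrite eq_le DcD sumr_ge0// => c' _; rewrite mulr_ge0// ltW.
    move=> /(_ (fun c' _ => mulr_ge0 (ltW (prior_gt0 c')) (Dc0 c')) c isT)/eqP.
    by rewrite mulf_eq0 gt_eqF//= => /eqP.
  have feasE (Dc : 'I_K -> R) : feasible prior D Dc -> Dc = fun=> 0.
    by move=> /feas Dc0; apply/funext.
  exists 0; split=> //.
  - move=> Dc; split=> [[/feas Dc0 _] c|Dc0]; first by rewrite Dc0 wd0.
    have {}Dc0 : feasible prior D Dc by apply/feas => c; rewrite Dc0 wd0.
    by split=> // Dc' /feasE ->; rewrite (feasE _ Dc0).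
  - by move=> c; rewrite wd0 rate0.
  - rewrite -sum_waterfill_rate// /conditional_rate.
    have -> : [set average_rate prior rate Dc | Dc in feasible prior D]%classic =
        [set (\sum_c (prior c)%:E * waterfill_rate (lam c) 0)%E]%classic.
      apply/seteqP; split=> [_ [Dc /feasE -> <-]|_ ->] /=.
        by apply: eq_bigr => c _; rewrite rate0.
      exists (fun=> 0); first exact/feas.
      by apply: eq_bigr => c _; rewrite rate0.
    exact: ereal_inf1.
  - by rewrite sum_waterfill_distortion big1// => c _; rewrite wd0 mulr0.
have D_gt0 : 0 < D by rewrite lt_neqAle eq_sym D_neq0.
have [mu mu0 DE] := water_level_exists N_gt0 prior_gt0 prior_sum1 lam_ge0 D_gt0 D_max.
have wd_ge0 c nu : 0 <= nu -> 0 <= waterfill_distortion (lam c) nu.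
  exact: waterfill_distortion_ge0 (lam_ge0 c).
have wd_lip c := @waterfill_distortion_lip R N N_gt0 (lam c).
exists mu; split.
- exact: ltW.
- move=> Dc; exact: (optimal_allocation_dist prior_gt0 rate_ge rate_wf wd_ge0 wd_lip).
- by move=> c; rewrite waterfill_rateE//; exact: rate_wf.
- rewrite (conditional_rate_dist prior_gt0 rate_ge rate_wf wd_ge0 mu0 DE).
  rewrite -sum_waterfill_rate// -sumEFin.
  by apply: eq_bigr => c _; rewrite waterfill_rateE.
- by rewrite sum_waterfill_distortion.
Qed.
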